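(* Let $\mathbb{F}$ be $\mathbb{R}$, $\mathbb{C}$ or $\mathbb{H}$. Let $V$ be a real algebraic variety and let $X \subseteq V$ be a compact subset. Then, for each positive integer $n$, every continuous map from $X$ into $\mathbb{G}(\mathbb{F}^n)$ can be approximated by piecewise-regular maps; that is, for every continuous map $f\colon X \to \mathbb{G}(\mathbb{F}^n)$, every neighborhood of $f$ in $\mathcal{C}(X,\mathbb{G}(\mathbb{F}^n))$ contains a piecewise-regular map.
   Context: A real algebraic variety is a locally ringed space isomorphic to an algebraic subset of $\mathbb{R}^m$ (for some $m$) endowed with the Zariski topology and the sheaf of real-valued regular functions (functions locally of the form $P/Q$ with $P,Q$ polynomials, $Q$ nowhere zero). Morphisms of real algebraic varieties are called regular maps. Each real algebraic variety also carries the Euclidean topology; all topological notions (compact, continuous, connected component, ...) refer to the Euclidean topology unless ''Zariski'' is specified. Regular map on a subset: let $V,W$ be real algebraic varieties, $X\subseteq V$ any subset, $Z$ the Zariski closure of $X$ in $V$. A map $f\colon X\to W$ is regular if there exist a Zariski open neighborhood $Z_0\subseteq Z$ of $X$ and a regular map $\tilde f\colon Z_0\to W$ with $\tilde f|_X=f$. A stratification of $V$ is a finite collection of pairwise disjoint Zariski locally closed subvarieties of $V$ (some possibly empty) whose union is $V$. A continuous map $f\colon X\to W$ is piecewise $\mathcal{S}$-regular, for a stratification $\mathcal{S}$ of $V$, if for every $S\in\mathcal{S}$ the restriction of $f$ to each connected component of $X\cap S$ is a regular map. It is piecewise-regular if it is piecewise $\mathcal{T}$-regular for some stratification $\mathcal{T}$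 of $V$. $\mathcal{C}(X,W)$ is the space of continuous maps from $X$ into $W$ with the compact-open topology. $\mathbb{F}$-vector spaces are left vector spaces ($\mathbb{H}$ denotes the quaternions). $\mathbb{G}_r(\mathbb{F}^n)$ is the Grassmannian of $r$-dimensional $\mathbb{F}$-vector subspaces of $\mathbb{F}^n$, regarded as a real algebraic variety in the standard way (e.g. identifying a subspace with the matrix of the orthogonal projection onto it), and $\mathbb{G}(\mathbb{F}^n)=\coprod_{r=0}^n\mathbb{G}_r(\mathbb{F}^n)$ is the disjoint union, also a real algebraic variety. *)

(* Defs.v *)
From HB Require Import structures.
From mathcomp Require Import all_boot all_order all_algebra.
From mathcomp Require Import all_classical all_reals all_analysis.
From mathcomp Require Import ring.
From mathcomp Require Import complex.
From mathcomp Require mpoly.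

Set Implicit Arguments.
Unset Strict Implicit.
Unset Printing Implicit Defensive.

Import Order.TTheory GRing.Theory Num.Theory.
Import numFieldNormedType.Exports.

Local Open Scope classical_set_scope.
Local Open Scope ring_scope.

(* A locally ringed space whose structure sheaf is a sheaf of real-valued
   functions.  [zopen] is its (Zariski) topology; [section U f] says that f
   restricted to U is a section over U, where U is meant to be [zopen] and the
   values of f outside U are irrelevant.  The topology of the carrier type is
   the Euclidean one: [compact], [continuous], [connected_component] always
   refer to it.  [real_algebraic_variety] ties the two topologies together. *)
Record ringed_space (R : realType) := RingedSpace {
  points :> topologicalType;
  zopen : set (set points);
  section : set points -> set (points -> R) }.

Section Spaces.
Context {R : realType}.
Implicit Types X Y V W : ringed_space R.

Definition ringed_morphism X Y (phi : X -> Y) : Prop :=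
  forall U, zopen U ->
    zopen (phi @^-1` U) /\
    forall g, section U g -> section (phi @^-1` U) (g \o phi).

Definition zclosed V : set (set V) := [set C | zopen (~` C)].

Definition zclosure V (A : set V) : set V := smallest (@zclosed V) A.

Definition zlocally_closed V (S : set V) : Prop :=
  exists O C, [/\ zopen O, zclosed C & S = O `&` C].

(* A subset with the induced topologies and the sheaf of functions that are
   locally restrictions of sections of the ambient space. *)
Definition subspace_of V (A : set V) : ringed_space R := {|
  points := set_type A;
  zopen := [set U | exists2 O, zopen O & U = \val @^-1` O];
  section := fun U => [set f | forall x, U x ->
    exists O g, [/\ zopen O, O (\val x), section O g &
      forall y, U y -> O (\val y) -> f y = g (\val y)]] |}.

Definition disjoint_union (I : choiceType) (X : I -> ringed_space R) :
    ringed_space R := {|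
  points := {i & points (X i)};
  zopen := [set U | forall i, zopen (existT _ i @^-1` U)];
  section := fun U => [set f | forall i,
    section (existT _ i @^-1` U) (fun x : X i => f (existT _ i x))] |}.

Definition peval m (p : mpoly.mpoly m R) (x : 'rV[R]_m) : R :=
  mpoly.meval (fun i => x ord0 i) p.

Definition algebraic m (Z : set 'rV[R]_m) : Prop :=
  exists S : set (mpoly.mpoly m R),
    Z = [set x | forall p, S p -> peval p x = 0].

Definition affine_space m : ringed_space R := {|
  points := 'rV[R]_m;
  zopen := [set O | algebraic (~` O)];
  section := fun U => [set f | forall x, U x ->
    exists O, [/\ algebraic (~` O), O x & exists P Q, forall y, U y -> O y ->
      peval Q y != 0 /\ f y = peval P y / peval Q y]] |}.

(* The isomorphism is also a homeomorphism for the Euclidean topologies: this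
   says that V carries the topology transported from 'rV[R]_m. *)
Definition real_algebraic_variety V : Prop :=
  exists m (Z : set (affine_space m)), algebraic Z /\
  exists (phi : V -> subspace_of Z) (psi : subspace_of Z -> V),
    [/\ cancel phi psi, cancel psi phi, ringed_morphism phi & ringed_morphism psi] /\
    continuous phi /\ continuous psi.

Definition regular_map V W (A : set V) (f : A -> W) : Prop :=
  exists Z0 : set V, [/\ A `<=` Z0,
    exists2 O, zopen O & Z0 = O `&` zclosure A &
    exists2 g : subspace_of Z0 -> W, ringed_morphism g &
      forall (a : A) (z : subspace_of Z0), \val a = \val z -> g z = f a].

Definition stratification V (SS : set (set V)) : Prop :=
  [/\ finite_set SS, trivIset SS id,
      forall S, SS S -> zlocally_closed S & \bigcup_(S in SS) S = setT].

Definition set_inclusion (T : Type) (A B : set T) (AB : A `<=` B) (a : A) : B :=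
  exist _ (\val a) (mem_set (AB _ (set_mem (valP a)))).

Lemma component_sub V (X S : set V) (x : V) :
  connected_component (X `&` S) x `<=` X.
Proof. by move=> y /connected_component_sub[]. Qed.

Definition piecewise_regular_for V W (X : set V) (SS : set (set V))
    (f : continuousType (set_type X) W) : Prop :=
  forall S, SS S -> forall x, (X `&` S) x ->
    regular_map (f \o set_inclusion (@component_sub V X S x)).

Definition piecewise_regular V W (X : set V)
    (f : continuousType (set_type X) W) : Prop :=
  exists SS : set (set V), stratification SS /\ piecewise_regular_for SS f.

End Spaces.

(* C(X, W): continuous maps, topologized as a subspace of all maps with the
   compact-open topology. *)
Definition continuous_maps (X W : topologicalType) : topologicalType :=
  initial_topology (id : continuousType X W -> {compact-open, X -> W}).

Record quaternion (R : Type) := Quaternion { qre : R; qi : R; qj : R; qk : R }.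

Section QuaternionRing.
Context {R : comNzRingType}.
Local Notation H := (quaternion R).

Definition quaternion_tuple (x : H) := (qre x, qi x, qj x, qk x).
Definition tuple_quaternion (t : R * R * R * R) : H :=
  let: (a, b, c, d) := t in Quaternion a b c d.
Lemma quaternion_tupleK : cancel quaternion_tuple tuple_quaternion.
Proof. by case. Qed.

HB.instance Definition _ := Choice.copy H (can_type quaternion_tupleK).

Definition quat_add (x y : H) :=
  Quaternion (qre x + qre y) (qi x + qi y) (qj x + qj y) (qk x + qk y).
Definition quat_opp (x : H) :=
  Quaternion (- qre x) (- qi x) (- qj x) (- qk x).
Definition quat_mul (x y : H) :=
  Quaternion
    (qre x * qre y - qi x * qi y - qj x * qj y - qk x * qk y)
    (qre x * qi y + qi x * qre y + qj x * qk y - qk x * qj y)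
    (qre x * qj y - qi x * qk y + qj x * qre y + qk x * qi y)
    (qre x * qk y + qi x * qj y - qj x * qi y + qk x * qre y).
Definition quat_conj (x : H) := Quaternion (qre x) (- qi x) (- qj x) (- qk x).

Lemma quat_addA : associative quat_add.
Proof. by move=> x y z; rewrite /quat_add /= !addrA. Qed.
Lemma quat_addC : commutative quat_add.
Proof. by move=> x y; congr Quaternion; rewrite addrC. Qed.
Lemma quat_add0 : left_id (Quaternion 0 0 0 0) quat_add.
Proof. by case=> a b c d; rewrite /quat_add /= !add0r. Qed.
Lemma quat_addN : left_inverse (Quaternion 0 0 0 0) quat_opp quat_add.
Proof. by case=> a b c d; rewrite /quat_add /= !addNr. Qed.

HB.instance Definition _ := GRing.isZmodule.Build H quat_addA quat_addC quat_add0 quat_addN.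

Lemma quat_mulA : associative quat_mul.
Proof. by move=> x y z; congr Quaternion => /=; ring. Qed.
Lemma quat_mul1l : left_id (Quaternion 1 0 0 0) quat_mul.
Proof. by case=> a b c d; congr Quaternion => /=; ring. Qed.
Lemma quat_mul1r : right_id (Quaternion 1 0 0 0) quat_mul.
Proof. by case=> a b c d; congr Quaternion => /=; ring. Qed.
Lemma quat_mulDl : left_distributive quat_mul quat_add.
Proof. by move=> x y z; congr Quaternion => /=; ring. Qed.
Lemma quat_mulDr : right_distributive quat_mul quat_add.
Proof. by move=> x y z; congr Quaternion => /=; ring. Qed.
Lemma quat_oner_neq0 : Quaternion 1 0 0 0 != 0 :> H.
Proof. by apply/eqP => -[] /eqP; rewrite oner_eq0. Qed.

HB.instance Definition _ := GRing.Zmodule_isNzRing.Build H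
  quat_mulA quat_mul1l quat_mul1r quat_mulDl quat_mulDr quat_oner_neq0.

End QuaternionRing.

Variant scalar_kind := RealScalars | ComplexScalars | QuaternionScalars.

Definition scalar_ring (R : realType) (F : scalar_kind) : nzRingType :=
  match F with
  | RealScalars => R
  | ComplexScalars => complex R
  | QuaternionScalars => quaternion R
  end.

Definition conj_scalar (R : realType) (F : scalar_kind) :
    scalar_ring R F -> scalar_ring R F :=
  match F return scalar_ring R F -> scalar_ring R F with
  | RealScalars => id
  | ComplexScalars => @conjc R
  | QuaternionScalars => @quat_conj R
  end.

Definition real_dim (F : scalar_kind) : nat :=
  match F with
  | RealScalars => 1
  | ComplexScalars => 2
  | QuaternionScalars => 4
  end.

Definition real_coords (R : realType) (F : scalar_kind) :
    scalar_ring R F -> seq R :=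
  match F return scalar_ring R F -> seq R with
  | RealScalars => fun x => [:: x]
  | ComplexScalars => fun z => [:: complex.Re z; complex.Im z]
  | QuaternionScalars => fun q => [:: qre q; qi q; qj q; qk q]
  end.

Section Grassmannian.
Variables (R : realType) (F : scalar_kind).
Local Notation K := (scalar_ring R F).
Local Notation d := (real_dim F).

(* The entries of P, listed row by row, each replaced by its coordinates. *)
Definition matrix_coords n (P : 'M[K]_n) : 'rV[R]_(n * n * d) :=
  mxvec (\matrix_(i < n * n, l < d) (real_coords (mxvec P ord0 i))`_l).

(* F^n is the left vector space 'rV[K]_n, on which matrices act linearly
   by right multiplication. *)
Definition herm n (x y : 'rV[K]_n) : K :=
  \sum_(i < n) x ord0 i * conj_scalar (y ord0 i).

(* The r rows of B form a basis of U. *)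
Definition subspace_dim n (r : nat) (U : set 'rV[K]_n) : Prop :=
  exists B : 'M[K]_(r, n),
    injective (fun c : 'rV_r => c *m B) /\ U = range (fun c : 'rV_r => c *m B).

Definition orthogonal_projection n (U : set 'rV[K]_n)
    (P : 'M[K]_n) : Prop :=
  forall x, U (x *m P) /\ forall u, U u -> herm (x - x *m P) u = 0.

(* A subspace is identified with the matrix of the orthogonal projection
   onto it. *)
Definition grassmannian_rank (n r : nat) : ringed_space R :=
  @subspace_of R (affine_space (n * n * d))
    [set v | exists U P, [/\ subspace_dim r U, orthogonal_projection U P &
                             v = matrix_coords P]].

Definition grassmannian (n : nat) : ringed_space R :=
  disjoint_union (fun r : 'I_n.+1 => grassmannian_rank n r).

End Grassmannian.

(* Main.v *)
(* Identify subspaces with orthogonal projections, so that f takes values in the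
   projections of a finite-dimensional real *-algebra A of matrices.  Cover X by
   finitely many balls {q_i > 0} on which f is close to a constant projection p_i.
   Where p m has the same rank as p, the orthogonal projection onto its row space,
   m^* p (p m m^* p + 1 - p)^-1 p m, is a rational function of m.  It serves
   to glue the p_i one ball at a time, interpolating with weights built from
   max(0, q_i): the result is continuous, and it is rational wherever the signs
   of all q_i are fixed.  The strata prescribe which q_i vanish; the signs of the
   other q_i are then constant on connected components.  On a component C on
   which q_i > 0, the glued projection g equals the projection onto the row space
   of p_i g, and this formula still has values in the Grassmannian on a Zariski
   neighbourhood of C. *)
From HB Require Import structures.
Require Import Defs.
From mathcomp Require Import all_boot all_order all_algebra.
From mathcomp Require Import all_classical all_reals all_analysis.
From mathcomp Require Import ring lra complex.
From mathcomp Require mpoly.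
Import (canonicals) mpoly.

Set Implicit Arguments.
Unset Strict Implicit.
Unset Printing Implicit Defensive.

Import Order.TTheory GRing.Theory Num.Theory.
Import numFieldNormedType.Exports.

Local Open Scope classical_set_scope.
Local Open Scope ring_scope.

(** The weighted average [h] of the [p i] is already continuous and close to [f], but the spectral
    projection nearest to it is in general not rational: it involves roots of a characteristic
    polynomial. Projecting onto the row space of [p i * h] is rational, but the result depends on
    [i], and no single [i] serves all of [X]. The gluing rests on two degenerations. If the weight
    of ball [i] tends to 0, the mixture tends to the projection [g] built so far, and [p i * g * h]
    has the same row space as [g * h] as soon as [p i] is close to [g]; so the new formula joins the
    old one. If the earlier weights tend to 0 while ball [i] keeps a positive weight, the mixture
    tends to 1, and [g], which need not have a limit there, drops out. Norms are kept squared ([Q],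
    [opb]), so that every estimate is a polynomial inequality; the constants are generous rather
    than sharp. *)

Definition dot (R : realType) D (u v : 'rV[R]_D) : R :=
  \sum_i u ord0 i * v ord0 i.

(* A finite-dimensional real algebra with an anti-involution adjoint to the
   Euclidean inner product: [co] gives the real coordinates, [sc] embeds the
   scalars.  The base field is R even for matrices over C or the quaternions, so
   that inverses can be computed by real determinants. *)
Record staralg (R : realType) := StarAlg {
  sa_ring :> pzRingType;
  sa_dim : nat;
  co : sa_ring -> 'rV[R]_sa_dim;
  uco : 'rV[R]_sa_dim -> sa_ring;
  sc : R -> sa_ring;
  star : sa_ring -> sa_ring;
  coK : cancel co uco;
  ucoK : cancel uco co;
  coD : {morph co : x y / x + y};
  sc_comm : forall r x, sc r * x = x * sc r;
  co_sc : forall r x, co (sc r * x) = r *: co x;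
  dot_star : forall x y a,
    dot (co (x * a)) (co y) = dot (co x) (co (y * star a)) }.

Section Dot.
Context {R : realType} {D : nat}.
Implicit Types u v w : 'rV[R]_D.

Lemma dotC u v : dot u v = dot v u.
Proof. by apply: eq_bigr => i _; rewrite mulrC. Qed.

Lemma dotDl u v w : dot (u + v) w = dot u w + dot v w.
Proof. by rewrite -big_split; apply: eq_bigr => i _; rewrite mxE mulrDl. Qed.

Lemma dotZl c u w : dot (c *: u) w = c * dot u w.
Proof. by rewrite mulr_sumr; apply: eq_bigr => i _; rewrite mxE mulrA. Qed.

Lemma dotNl u w : dot (- u) w = - dot u w.
Proof. by rewrite -scaleN1r dotZl mulN1r. Qed.

Lemma dotNr u w : dot w (- u) = - dot w u.
Proof. by rewrite !(dotC w) dotNl. Qed.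

Lemma dot0l w : dot 0 w = 0.
Proof. by rewrite -(scale0r 0) dotZl mul0r. Qed.

Lemma dot0r w : dot w 0 = 0.
Proof. by rewrite dotC dot0l. Qed.

Lemma dotBl u v w : dot (u - v) w = dot u w - dot v w.
Proof. by rewrite dotDl dotNl. Qed.

Lemma dotBr u v w : dot w (u - v) = dot w u - dot w v.
Proof. by rewrite !(dotC w) dotBl. Qed.

Lemma dotDr u v w : dot w (u + v) = dot w u + dot w v.
Proof. by rewrite !(dotC w) dotDl. Qed.

Lemma dotZr c u w : dot w (c *: u) = c * dot w u.
Proof. by rewrite !(dotC w) dotZl. Qed.

Lemma dot_suml (I : Type) (s : seq I) (F : I -> 'rV[R]_D) w :
  dot (\sum_(i <- s) F i) w = \sum_(i <- s) dot (F i) w.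
Proof.
by elim/big_rec2: _ => [|i x y _ IH]; rewrite ?dot0l// dotDl IH.
Qed.

Lemma dot_ge0 u : 0 <= dot u u.
Proof. by apply: sumr_ge0 => i _; rewrite -expr2 sqr_ge0. Qed.

Lemma dot_eq0 u : dot u u = 0 -> u = 0.
Proof.
move=> /eqP; rewrite psumr_eq0 => [/allP u0|i _]; last by rewrite -expr2 sqr_ge0.
apply/rowP => i; rewrite mxE; apply/eqP.
by have := u0 i (mem_index_enum i); rewrite /= mulf_eq0 orbb.
Qed.

End Dot.

(** * Inverses, projections and row spaces in a real star-algebra *)

Section StarAlgebra.
Context {R : realType} {A : staralg R}.
Implicit Types (x y z a b p : A) (r : R).
Local Notation D := (sa_dim A).

Lemma co_inj : injective (@co R A).
Proof. exact: can_inj (@coK R A). Qed.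

Lemma co0 : co (0 : A) = 0.
Proof. by apply: (addrI (co (0 : A))); rewrite -coD !addr0. Qed.

Lemma coN x : co (- x) = - co x.
Proof. by apply: (addrI (co x)); rewrite -coD !subrr co0. Qed.

Lemma coB x y : co (x - y) = co x - co y.
Proof. by rewrite coD coN. Qed.

Lemma co_sum (I : Type) (s : seq I) (P : pred I) (F : I -> A) :
  co (\sum_(i <- s | P i) F i) = \sum_(i <- s | P i) co (F i).
Proof. exact: (big_morph _ (@coD R A) co0). Qed.

Lemma co_scr r x : co (x * sc A r) = r *: co x.
Proof. by rewrite -sc_comm co_sc. Qed.

Definition basis (i : 'I_D) : A := uco (delta_mx ord0 i).

Lemma basis_sum x : x = \sum_i sc A (co x ord0 i) * basis i.
Proof.
apply: co_inj; rewrite co_sum [LHS]row_sum_delta.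
by apply: eq_bigr => i _; rewrite co_sc ucoK.
Qed.

Definition lmx a : 'M[R]_D := \matrix_(i, j) co (basis i * a) ord0 j.

Lemma coM x a : co (x * a) = co x *m lmx a.
Proof.
rewrite [in LHS](basis_sum x) mulr_suml co_sum; apply/rowP => j.
rewrite summxE !mxE; apply: eq_bigr => i _.
by rewrite -mulrA co_sc !mxE.
Qed.

Lemma co_sc1 r : co (sc A r) = r *: co (1 : A).
Proof. by rewrite -co_sc mulr1. Qed.

Lemma scD r s : sc A (r + s) = sc A r + sc A s.
Proof. by apply: co_inj; rewrite coD !co_sc1 scalerDl. Qed.

Lemma sc1 : sc A 1 = 1.
Proof. by apply: co_inj; rewrite co_sc1 scale1r. Qed.

Lemma sc0 : sc A 0 = 0.
Proof. by apply: co_inj; rewrite co_sc1 scale0r co0. Qed.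

Lemma dot_inj a b : (forall x, dot (co x) (co a) = dot (co x) (co b)) -> a = b.
Proof.
move=> ab; apply/eqP; rewrite -subr_eq0; apply/eqP/co_inj.
by rewrite co0; apply: dot_eq0; rewrite {2}coB dotBr !ab subrr.
Qed.

(** Adjointness is the only law that the record postulates for [star]; since it determines [star],
    all the others follow. *)
Lemma star_uniq a b :
  (forall x y, dot (co (x * a)) (co y) = dot (co x) (co (y * b))) -> star a = b.
Proof.
by move=> ab; apply: dot_inj => x; rewrite -[star a]mul1r -[b]mul1r -ab dot_star.
Qed.

Lemma starM a b : star (a * b) = star b * star a.
Proof. by apply: star_uniq => x y; rewrite !mulrA !dot_star. Qed.

Lemma starD a b : star (a + b) = star a + star b.
Proof. by apply: star_uniq => x y; rewrite !mulrDr !coD dotDl dotDr !dot_star. Qed.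

Lemma starK a : star (star a) = a.
Proof. by apply: star_uniq => x y; rewrite dotC -dot_star dotC. Qed.

Lemma star1 : star (1 : A) = 1.
Proof. by apply: star_uniq => x y; rewrite !mulr1. Qed.

Lemma starN a : star (- a) = - star a.
Proof.
by apply: star_uniq => x y; rewrite !mulrN !coN dotNl dotNr dot_star.
Qed.

Lemma star_sc r : star (sc A r) = sc A r.
Proof. by apply: star_uniq => x y; rewrite !co_scr dotZl dotZr. Qed.

Lemma star_coE a : star a = \sum_i sc A (co a ord0 i) * star (basis i).
Proof.
rewrite [in LHS](basis_sum a).
have -> (I : Type) (s : seq I) (F : I -> A) :
    star (\sum_(i <- s) F i) = \sum_(i <- s) star (F i).
  by apply: (big_morph _ starD); apply: star_uniq => x y; rewrite !mulr0 co0 dot0l dot0r.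
by apply: eq_bigr => i _; rewrite starM star_sc sc_comm.
Qed.

Definition Q x : R := dot (co x) (co x).

Lemma Q_ge0 x : 0 <= Q x. Proof. exact: dot_ge0. Qed.

Lemma Q_eq0 x : Q x = 0 -> x = 0.
Proof. by move=> /dot_eq0 x0; apply: co_inj; rewrite x0 co0. Qed.

Lemma Q0 : Q 0 = 0.
Proof. by rewrite /Q co0 dot0l. Qed.

Lemma Q_sc r x : Q (sc A r * x) = r ^+ 2 * Q x.
Proof. by rewrite /Q co_sc dotZl dotZr mulrA expr2. Qed.

Lemma QN x : Q (- x) = Q x.
Proof. by rewrite /Q coN dotNl dotNr opprK. Qed.

Lemma parallelogram x y : Q (x + y) + Q (x - y) = 2 * Q x + 2 * Q y.
Proof. by rewrite /Q !coD !coN !dotDl !dotDr !dotNl !dotNr; ring. Qed.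

Lemma QD x y : Q (x + y) <= 2 * Q x + 2 * Q y.
Proof. by rewrite -parallelogram lerDl Q_ge0. Qed.

Lemma QB x y : Q (x - y) <= 2 * Q x + 2 * Q y.
Proof. by rewrite -(QN y) QD. Qed.

(* Bounds the square of the operator norm of right multiplication by [a]. *)
Definition opb a (c : R) := forall x, Q (x * a) <= c * Q x.

Lemma opbN a c : opb a c -> opb (- a) c.
Proof. by move=> ac x; rewrite mulrN QN. Qed.

Lemma opbD a b c d : opb a c -> opb b d -> opb (a + b) (2 * c + 2 * d).
Proof.
move=> ac bd x; rewrite mulrDr; apply: le_trans (QD _ _) _.
by have := ac x; have := bd x; lra.
Qed.

(** Expanding [Q (x * star a * a - sc A c * x) >= 0] replaces the Cauchy-Schwarz inequality and its
    square roots. *)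
Lemma opb_star a c : 0 < c -> opb a c -> opb (star a) c.
Proof.
move=> c0 ac x; have := ac (x * star a).
have e : Q (x * star a) = dot (co (x * star a * a)) (co x).
  by rewrite /Q -[X in dot _ (co (_ * X))]starK -dot_star starK.
set z := x * star a * a in e *; set q := Q (x * star a) in e * => zq.
have : 0 <= Q (z - sc A c * x) by exact: Q_ge0.
rewrite /Q coB co_sc dotBl !dotBr !dotZl !dotZr -(dotC (co z)) -e.
rewrite -/(Q z) -/(Q x) => h.
have : 0 <= c * (c * Q x - q) by nra.
by rewrite pmulr_rge0// subr_ge0.
Qed.

Definition injective_alg a := forall x, x * a = 0 -> x = 0.

(* The Cramer formula, which is rational even where [a] is not invertible. *)
Definition inva a : A :=
  uco (co 1 *m ((\det (lmx a))^-1 *: \adj (lmx a))).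

Lemma lmx_unit a : injective_alg a -> lmx a \in unitmx.
Proof.
move=> ia; rewrite -row_free_unit; apply: inj_row_free => v va.
by rewrite -[v]ucoK (ia (uco v)) ?co0//; apply: co_inj; rewrite coM ucoK va co0.
Qed.

Lemma det_lmx a : injective_alg a <-> \det (lmx a) != 0.
Proof.
split=> [/lmx_unit|d0 x xa]; first by rewrite unitmxE unitfE.
have ua : lmx a \in unitmx by rewrite unitmxE unitfE.
by apply: co_inj; rewrite -[co x](mulmxK ua) -coM xa co0 mul0mx.
Qed.

Lemma mulVa a : injective_alg a -> inva a * a = 1.
Proof.
move=> /lmx_unit ua; apply: co_inj; rewrite coM ucoK.
have <- : invmx (lmx a) = (\det (lmx a))^-1 *: \adj (lmx a) by rewrite /invmx ua.
by rewrite mulmxKV.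
Qed.

Lemma mulaV a : injective_alg a -> a * inva a = 1.
Proof.
move=> ia; apply/eqP; rewrite -subr_eq0; apply/eqP/ia.
by rewrite mulrBl -mulrA mulVa// mulr1 mul1r subrr.
Qed.

Lemma inva_uniq a b : injective_alg a -> b * a = 1 -> b = inva a.
Proof. by move=> ia ba; rewrite -[b]mulr1 -(mulaV ia) mulrA ba mul1r. Qed.

Lemma star_inva a : injective_alg a -> star a = a -> star (inva a) = inva a.
Proof.
by move=> ia sa; apply: inva_uniq => //; rewrite -{2}sa -starM mulaV// star1.
Qed.

Definition projection p := p * p = p /\ star p = p.

Lemma projection_unique p q : projection p -> projection q ->
  p * q = p -> q * p = q -> p = q.
Proof. by move=> [_ sp] [_ sq] pq qp; rewrite -sp -pq starM sp sq qp. Qed.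

Lemma Q_projection p x : projection p -> Q x = Q (x * p) + Q (x * (1 - p)).
Proof.
move=> [pp sp].
have o : dot (co (x * p)) (co (x * (1 - p))) = 0.
  by rewrite dot_star sp -mulrA mulrBl mul1r pp subrr mulr0 co0 dot0r.
have e : x = x * p + x * (1 - p) by rewrite -mulrDr subrKC mulr1.
rewrite {1}/Q {1 2}e coD dotDl !dotDr o.
by rewrite (dotC (co (x * (1 - p)))) o addr0 add0r.
Qed.

Lemma projectionC p : projection p -> projection (1 - p).
Proof.
move=> [pp sp]; split; last by rewrite starD starN star1 sp.
by rewrite mulrBl mul1r mulrBr mulr1 pp subrr subr0.
Qed.

Lemma Q_proj_le p x : projection p -> Q (x * p) <= Q x.
Proof. by move=> pp; rewrite (Q_projection x pp) lerDl Q_ge0. Qed.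

(** For [p * m = m], the element [m * star m] lives on [A p] only; the summand [1 - p] lets it be
    inverted in the whole algebra, without choosing a basis of [A p]. *)
Definition gram p m : A := m * star m + (1 - p).

(* [row_proj p m] is the orthogonal projection onto the left ideal [A m],
   provided that [m = p m] and that [m] is injective on [A p]. *)
Definition row_proj p m : A := star m * inva (gram p m) * m.

Section RowProj.
Variables (p m : A) (pp : projection p) (pm : p * m = m).

Lemma gram_injective : (forall x, x * p * m = 0 -> x * p = 0) ->
  injective_alg (gram p m).
Proof.
have [ppp sp] := pp => im x.
have gp : gram p m * p = m * star m.
  rewrite /gram mulrDl -mulrA (_ : star m * p = star m); last by rewrite -[in RHS]pm starM sp.
  by rewrite mulrBl mul1r ppp subrr addr0.
move=> xg; have /(congr1 (fun y => y * p)) := xg.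
rewrite -mulrA gp mul0r => xmm.
have xm : x * m = 0.
  by apply: Q_eq0; rewrite /Q dot_star -mulrA xmm co0 dot0r.
have xp : x * p = 0 by apply: im; rewrite -mulrA pm.
by move: xg; rewrite /gram mulrDr xmm add0r mulrBr mulr1 xp subr0.
Qed.

Hypothesis ig : injective_alg (gram p m).

Lemma gram_star : star (gram p m) = gram p m.
Proof. by rewrite /gram starD starM starK starD starN star1 pp.2. Qed.

Lemma pgram : p * gram p m = m * star m.
Proof. by rewrite /gram mulrDr mulrA pm mulrBr mulr1 pp.1 subrr addr0. Qed.

Lemma mul_row_proj : m * row_proj p m = m.
Proof.
by rewrite /row_proj !mulrA -pgram -(mulrA p) mulaV// mulr1.
Qed.

Lemma row_proj_projection : projection (row_proj p m).
Proof.
split; first by rewrite {1}/row_proj -mulrA mul_row_proj.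
by rewrite /row_proj !starM starK star_inva ?gram_star// mulrA.
Qed.

Lemma row_proj_injective x : x * p * m = 0 -> x * p = 0.
Proof.
move=> xm; have : x * p * gram p m = 0.
  rewrite /gram mulrDr mulrA xm mul0r add0r mulrBr mulr1.
  by rewrite -(mulrA x) pp.1 subrr.
by move/ig.
Qed.

End RowProj.

(** The qualitative half of the Neumann series: [x * a = 0] would give [Q x <= c * Q x]. *)
Lemma near_projection_injective a c : c < 1 -> opb (a - 1) c -> injective_alg a.
Proof.
move=> c1 h x xa; apply: Q_eq0.
have := h x; rewrite mulrBr xa mulr1 sub0r QN.
by have := Q_ge0 x; nra.
Qed.

End StarAlgebra.

Ltac abel := apply: co_inj; rewrite ?(coD, coN, co0);
  apply/rowP => ?; rewrite ?mxE; ring.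

(** * Perturbation of projections *)

Section Estimates.
Context {R : realType} {A : staralg R}.
Implicit Types (x y z u v w f g h p m W : A) (c e s : R).

Lemma opb_id_injective p m c : c < 1 -> (forall u, u * p = u -> Q (u * m - u) <= c * Q u) ->
  p * p = p -> forall x, x * p * m = 0 -> x * p = 0.
Proof.
move=> c1 h pp x xm; apply: Q_eq0; have := h (x * p).
rewrite -mulrA pp => /(_ erefl); rewrite xm sub0r QN.
by have := Q_ge0 (x * p); nra.
Qed.

Section Step.
Variables (f p h W : A) (d e : R).
Hypotheses (pf : projection f) (pp : projection p).
Hypotheses (d0 : d <= 1 / 1000) (e0 : 0 < e <= 1 / 1000).
Hypotheses (pfd : opb (p - f) d) (hfe : opb (h - f) e).
Hypothesis Wd : forall u, u * p = u -> Q (u * W - u) <= 2 / 1000 * Q u.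
Let m := p * W * h.

Let pm : p * m = m. Proof. by rewrite /m !mulrA pp.1. Qed.

Let Q_W u : u * p = u -> Q (u * W) <= 4 * Q u.
Proof.
move=> up; rewrite -(subrK u (u * W)); apply: le_trans (QD _ _) _.
by have := Wd up; have := Q_ge0 u; lra.
Qed.

Let Q_mB u : u * p = u -> Q (u * m - u) <= 1 / 16 * Q u.
Proof.
move=> up.
(* The errors of [h], [W] and [p], in this order. With the factors 2 of [QD] they add up to at most
   20/1000 of [Q u]. *)
have -> : u * m - u = u * W * (h - f) + ((u * W - u) * f + u * (f - p)).
  by rewrite /m !mulrA up !(mulrBr, mulrBl) up; abel.
apply: le_trans (QD _ _) _.
have := QD ((u * W - u) * f) (u * (f - p)).
have := hfe (u * W); have := Q_W up; have := Wd up.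
have := Q_proj_le (u * W - u) pf.
have := pfd u; rewrite -opprB mulrN QN.
have [_ e1] := andP e0; have := Q_ge0 u.
have := ler_wpM2r (Q_ge0 u) d0; have := ler_wpM2r (Q_ge0 (u * W)) e1; lra.
Qed.

Let Q_le_m u : u * p = u -> Q u <= 4 * Q (u * m).
Proof.
move=> up; have := QB (u * m) (u * m - u); rewrite subKr.
by have := Q_mB up; have := Q_ge0 u; lra.
Qed.

Let Q_m_le u : u * p = u -> Q (u * m) <= 4 * Q u.
Proof.
move=> up; have := QD (u * m - u) u; rewrite subrK.
by have := Q_mB up; have := Q_ge0 u; lra.
Qed.

Lemma step_gram_injective : injective_alg (gram p m).
Proof.
apply: gram_injective => //.
by apply: (@opb_id_injective _ _ (1 / 16)) Q_mB pp.1; lra.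
Qed.

Let ig := step_gram_injective.
Local Notation E := (row_proj p m).

(** Since [f * (1 - f) = 0], only [h - f] survives. This is where [d] and the error of [W] leave the
    estimate. *)
Let m_near u : u * p = u -> Q (u * m * (1 - f)) <= 16 * e * Q (u * m).
Proof.
move=> up; have -> : u * m * (1 - f) = u * W * (h - f) * (1 - f).
  rewrite /m !mulrA up (mulrBr (u * W)) [RHS]mulrBl.
  by rewrite -(mulrA _ f) (mulrBr f) mulr1 pf.1 subrr mulr0 subr0.
apply: le_trans (Q_proj_le _ (projectionC pf)) _; apply: le_trans (hfe _) _.
have := Q_W up; have := Q_le_m up; have [e1 _] := andP e0; nra.
Qed.

(** The bound depends on [e] alone: [p] and [W] need only be moderately good, because the rows of
    [m] end in [h] and hence almost lie in the range of [f]. The constant is 2 * 16 + 2 * 256, from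
    the two inclusions [Ef] and [fE]. *)
Lemma step_near : opb (E - f) (544 * e).
Proof.
have [e1 e2] := andP e0.
have pE := row_proj_projection pp pm ig.
(* [D] is the compression of [m] to [A f], completed by the identity. Its inverse writes each
   [v * f] as [w * (f * m * f)] with [Q w <= 4 * Q v], so that [m] almost reaches the whole range of
   [f]. *)
pose D := f * m * f + (1 - f).
have Df : D * f = f * m * f.
  by rewrite mulrDl mulrBl mul1r pf.1 subrr addr0 -mulrA pf.1.
have DB v : Q (v * (D - 1)) <= 1 / 4 * Q v.
  have -> : v * (D - 1) = ((v * f * p * m - v * f * p) + v * f * (p - f)) * f.
    rewrite -(mulrA _ p m) pm /D !(mulrBr, mulrBl, mulrDr, mulrDl, mulr1, mulrA).
    by rewrite -(mulrA v f f) pf.1 -(mulrA v f f) pf.1; abel.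
  apply: le_trans (Q_proj_le _ pf) _; apply: le_trans (QD _ _) _.
  have vp : v * f * p * p = v * f * p by rewrite -mulrA pp.1.
  have := Q_mB vp; have := Q_proj_le (v * f) pp; have := Q_proj_le v pf.
  have := pfd (v * f); have := Q_ge0 v; have := Q_ge0 (v * f).
  have := ler_wpM2r (Q_ge0 (v * f)) d0; lra.
have iD : injective_alg D by apply: near_projection_injective DB; lra.
have QV v : Q (v * inva D) <= 4 * Q v.
  set w := v * inva D; have <- : w * D = v by rewrite /w -mulrA mulVa// mulr1.
  have := QB (w * D) (w * (D - 1)).
  by rewrite {1}mulrBr mulr1 subKr; have := DB w; lra.
have fE v : Q (v * (f * (1 - E))) <= 256 * e * Q v.
  set w := v * inva D.
  have wD : w * (f * m * f) = v * f by rewrite -Df mulrA /w -(mulrA v) mulVa// mulr1.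
  set u := w * f * p.
  have up : u * p = u by rewrite /u -mulrA pp.1.
  have umE : u * m = w * f * m by rewrite /u -mulrA pm.
  (* [v * f] is the [f]-part of [u * m], and [1 - E] kills [u * m]; what remains is the small part
     [u * m * (1 - f)]. *)
  have -> : v * (f * (1 - E)) = - (u * m * (1 - f)) * (1 - E).
    have yE : u * m * E = u * m by rewrite -mulrA mul_row_proj.
    have yf : u * m * f = v * f by rewrite umE -wD !mulrA.
    rewrite mulNr !(mulrBr, mulrBl) !mulr1 yE yf mulrA.
    by abel.
  apply: le_trans (Q_proj_le _ (projectionC pE)) _; rewrite QN.
  apply: le_trans (m_near up) _.
  have := Q_m_le up; have := QV v; rewrite -/w.
  have := Q_proj_le (w * f) pp; have := Q_proj_le w pf; rewrite -/u => *.
  have h' : Q (u * m) <= 16 * Q v by lra.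
  by apply: le_trans (ler_wpM2l _ h') _; lra.
have Ef v : Q (v * (E * (1 - f))) <= 16 * e * Q v.
  pose u := v * star m * inva (gram p m) * p.
  have uE : v * E = u * m by rewrite /u -[RHS]mulrA pm /row_proj !mulrA.
  have up : u * p = u by rewrite /u -mulrA pp.1.
  rewrite mulrA uE; apply: le_trans (m_near up) _.
  by rewrite -uE; have := Q_proj_le v pE; nra.
(* [star] turns the bound for [f * (1 - E)] into one for [(1 - E) * f]. *)
have -> : E - f = E * (1 - f) - star (f * (1 - E)).
  by rewrite starM (projectionC pE).2 pf.2 mulrBr mulr1 mulrBl mul1r; abel.
have := opbD Ef (opbN (opb_star _ fE)).
rewrite (_ : 2 * _ + 2 * _ = 544 * e); last by ring.
by apply; nra.
Qed.

End Step.

(** On [A p] the identity acts as [p], so mixing 1 with [g] costs no more than the distance between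
    [p] and [g], estimated through [f]. *)
Lemma weight_near f p g s a b : projection p -> opb (p - f) a -> opb (g - f) b ->
  0 <= s <= 1 -> forall u, u * p = u ->
  Q (u * (sc A (1 - s) + sc A s * g) - u) <= (2 * a + 2 * b) * Q u.
Proof.
move=> pp pfa gfb /andP[s0 s1] u up.
have -> : u * (sc A (1 - s) + sc A s * g) - u = sc A s * (u * (g - f) - u * (p - f)).
  have e : sc A (1 - s) = 1 - sc A s.
    by apply: (addIr (sc A s)); rewrite -scD !subrK sc1.
  rewrite e !(mulrBr, mulrDr) up mulr1 !mulrA -(sc_comm s u).
  by abel.
rewrite Q_sc; have := QB (u * (g - f)) (u * (p - f)).
have := pfa u; have := gfb u; have := Q_ge0 (u * (g - f) - u * (p - f)).
have : s ^+ 2 <= 1 by rewrite expr_le1.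
have := sqr_ge0 s; nra.
Qed.

End Estimates.

(** * Independence of the reference projection *)

Section Absorb.
Context {R : realType} {A : staralg R}.
Implicit Types (p g h x : A).

(** The row space of [p * g * h] lies in that of [g * h]. Conversely [g * p * g] is close to [g],
    hence invertible on [A g], which recovers [g * h] from [p * g * h]. *)
Lemma row_proj_absorb p g h (c : R) : c < 1 -> opb (p - g) c ->
  projection p -> projection g ->
  injective_alg (gram p (p * g * h)) -> injective_alg (gram g (g * h)) ->
  row_proj p (p * g * h) = row_proj g (g * h).
Proof.
move=> c1 pgc pp pg i1 i2.
have pm : p * (p * g * h) = p * g * h by rewrite !mulrA pp.1.
have gm : g * (g * h) = g * h by rewrite mulrA pg.1.
apply: projection_unique; do 1?exact: row_proj_projection.
  by rewrite {1}/row_proj -mulrA -(mulrA p g h) -(mulrA p) mul_row_proj.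
pose D := g * p * g + (1 - g).
have iD : injective_alg D.
  apply: (near_projection_injective c1) => v.
  have -> : v * (D - 1) = v * g * (p - g) * g.
    rewrite /D !(mulrBr, mulrBl, mulrDr, mulr1, mulrA).
    by rewrite -(mulrA v g g) pg.1 -(mulrA v g g) pg.1; abel.
  apply: le_trans (Q_proj_le _ pg) _; apply: le_trans (pgc _) _.
  have [c0|c0] := lerP 0 c; first by apply: ler_wpM2l => //; exact: Q_proj_le.
  have := pgc v; have := Q_ge0 (v * (p - g)); have := pgc (v * g).
  have := Q_ge0 (v * g * (p - g)); have := Q_ge0 v; have := Q_ge0 (v * g); nra.
have Dg : D * g = g * p * g.
  by rewrite mulrDl mulrBl mul1r pg.1 subrr addr0 -mulrA pg.1.
have e : g * h = inva D * g * (p * g * h).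
  by rewrite -[g in LHS]mul1r -(mulVa iD) -(mulrA _ D) Dg !mulrA.
have eE : g * h * row_proj p (p * g * h) = g * h.
  by rewrite {1}e -(mulrA (inva D * g)) mul_row_proj// -e.
by rewrite {1}/row_proj -mulrA eE.
Qed.

Lemma near_gram_injective p g (c : R) : c < 1 -> opb (p - g) c -> projection p ->
  injective_alg (gram p (p * g)).
Proof.
move=> c1 pgc pp; apply: gram_injective => //; first by rewrite mulrA pp.1.
apply: (@opb_id_injective _ _ _ _ c) pp.1 => // u up.
by rewrite mulrA up -[u in _ - u]up -mulrBr -opprB mulrN QN.
Qed.

(** The case [h = 1] of [row_proj_absorb]. The left-hand side is a projection for every [g] whose
    Gram element is invertible, so it extends a family of projections to places where [g] is no
    longer one. *)
Lemma row_proj_id p g (c : R) : c < 1 -> opb (p - g) c ->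
  projection p -> projection g -> row_proj p (p * g) = g.
Proof.
move=> c1 pgc pp pg.
have g1 : gram g (g * 1) = 1 by rewrite /gram mulr1 pg.2 pg.1 addrC subrK.
have i1 : injective_alg (1 : A) by move=> x; rewrite mulr1.
have := @row_proj_absorb p g 1 c c1 pgc pp pg; rewrite mulr1 => -> //.
- by rewrite /row_proj g1 -(inva_uniq i1 (mul1r 1)) !mulr1 pg.2 pg.1.
- exact: near_gram_injective pgc pp.
- by rewrite g1.
Qed.

End Absorb.

(* Both the functions that are rational on [S] and those continuous at the
   point of a singleton [S] form such a class. *)
Definition function_class (R : realType) (Y : Type) (S : set Y)
    (Phi : (Y -> R) -> Prop) : Prop :=
  [/\ forall c, Phi (fun=> c),
      forall u v, Phi u -> Phi v -> Phi (fun x => u x + v x),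
      forall u v, Phi u -> Phi v -> Phi (fun x => u x * v x) &
      forall u, Phi u -> (forall x, S x -> u x != 0) -> Phi (fun x => (u x)^-1)].

Section FunctionClass.
Context {R : realType} {A : staralg R} {Y : Type} {S : set Y}.
Context {Phi : (Y -> R) -> Prop} (cPhi : function_class S Phi).
Local Notation D := (sa_dim A).

Lemma class_sum (I : Type) (s : seq I) (F : I -> Y -> R) :
  (forall i, Phi (F i)) -> Phi (fun x => \sum_(i <- s) F i x).
Proof.
move=> PF; have [Pc PD _ _] := cPhi; elim: s => [|i s IH].
  by under eq_fun do rewrite big_nil; exact: Pc.
by under eq_fun do rewrite big_cons; exact: PD.
Qed.

Lemma class_prod (I : Type) (s : seq I) (F : I -> Y -> R) :
  (forall i, Phi (F i)) -> Phi (fun x => \prod_(i <- s) F i x).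
Proof.
move=> PF; have [Pc _ PM _] := cPhi; elim: s => [|i s IH].
  by under eq_fun do rewrite big_nil; exact: Pc.
by under eq_fun do rewrite big_cons; exact: PM.
Qed.

Lemma class_exp (u : Y -> R) k : Phi u -> Phi (fun x => u x ^+ k).
Proof.
move=> Pu; have [Pc _ PM _] := cPhi; elim: k => [|k IH].
  by under eq_fun do rewrite expr0; exact: Pc.
by under eq_fun do rewrite exprS; exact: PM.
Qed.

Lemma class_det k (M : Y -> 'M[R]_k) : (forall i j, Phi (fun x => M x i j)) ->
  Phi (fun x => \det (M x)).
Proof.
move=> PM; have [Pc _ PP _] := cPhi.
by apply: class_sum => s; apply: PP => //; exact: class_prod.
Qed.

Lemma class_adj k (M : Y -> 'M[R]_k) : (forall i j, Phi (fun x => M x i j)) ->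
  forall i j, Phi (fun x => (\adj (M x)) i j).
Proof.
move=> PM i j; have [Pc _ PP _] := cPhi.
under eq_fun do rewrite mxE; apply: PP => //; apply: class_det => i' j'.
by under eq_fun do rewrite !mxE.
Qed.

Definition class_alg (u : Y -> A) := forall j, Phi (fun x => co (u x) ord0 j).

Lemma class_cst a : class_alg (fun=> a).
Proof. by move=> j; have [Pc _ _ _] := cPhi. Qed.

Lemma class_algD u v : class_alg u -> class_alg v ->
  class_alg (fun x => u x + v x).
Proof.
move=> Pu Pv j; have [_ PD _ _] := cPhi.
by under eq_fun do rewrite coD mxE; exact: PD.
Qed.

Lemma class_scM r u : Phi r -> class_alg u -> class_alg (fun x => sc A (r x) * u x).
Proof.
move=> Pr Pu j; have [_ _ PM _] := cPhi.
by under eq_fun do rewrite co_sc mxE; exact: PM.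
Qed.

Lemma class_sc r : Phi r -> class_alg (fun x => sc A (r x)).
Proof.
move=> Pr; have := class_scM Pr (class_cst 1).
by under eq_fun do rewrite mulr1.
Qed.

Lemma class_algN u : class_alg u -> class_alg (fun x => - u x).
Proof.
move=> Pu j; have [Pc _ PM _] := cPhi.
under eq_fun do rewrite coN mxE -mulN1r.
exact: PM.
Qed.

Lemma class_alg_sum (I : Type) (s : seq I) (F : I -> Y -> A) :
  (forall i, class_alg (F i)) -> class_alg (fun x => \sum_(i <- s) F i x).
Proof.
move=> PF j; under eq_fun do rewrite co_sum summxE.
by apply: class_sum => i; exact: PF.
Qed.

Lemma class_lmx u : class_alg u -> forall i j, Phi (fun x => lmx (u x) i j).
Proof.
move=> Pu i j; have [Pc _ PM _] := cPhi.
have e x : lmx (u x) i j =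
    \sum_k co (u x) ord0 k * co (basis i * basis k : A) ord0 j.
  rewrite mxE [in LHS](basis_sum (u x)) mulr_sumr co_sum summxE.
  by apply: eq_bigr => k _; rewrite mulrA -sc_comm -mulrA co_sc mxE.
by under eq_fun do rewrite e; apply: class_sum => k; exact: PM.
Qed.

Lemma class_algM u v : class_alg u -> class_alg v ->
  class_alg (fun x => u x * v x).
Proof.
move=> Pu Pv j; have [_ _ PM _] := cPhi.
under eq_fun do rewrite coM mxE; apply: class_sum => k.
by apply: PM => //; exact: class_lmx.
Qed.

Lemma class_star u : class_alg u -> class_alg (fun x => star (u x)).
Proof.
move=> Pu; under eq_fun do rewrite star_coE; apply: class_alg_sum => i.
by apply: class_scM => //; exact: class_cst.
Qed.

Lemma class_inva u : class_alg u -> (forall x, S x -> injective_alg (u x)) ->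
  class_alg (fun x => inva (u x)).
Proof.
move=> Pu iu j; have [Pc _ PM PV] := cPhi.
under eq_fun do rewrite ucoK mxE; apply: class_sum => k; apply: (PM) => //.
under eq_fun do rewrite mxE; apply: PM; last exact/class_adj/class_lmx.
apply: PV; first exact/class_det/class_lmx.
by move=> x Sx; apply/det_lmx/iu.
Qed.

Lemma class_gram p m : class_alg p -> class_alg m ->
  class_alg (fun x => gram (p x) (m x)).
Proof.
move=> Pp Pm; apply: class_algD; first exact/class_algM/class_star.
by apply: class_algD; [exact: class_cst|exact: class_algN].
Qed.

Lemma class_row_proj p m : class_alg p -> class_alg m ->
  (forall x, S x -> injective_alg (gram (p x) (m x))) ->
  class_alg (fun x => row_proj (p x) (m x)).
Proof.
move=> Pp Pm ig; apply: class_algM => //; apply: class_algM.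
  exact: class_star.
by apply: class_inva => //; exact: class_gram.
Qed.

End FunctionClass.
Arguments class_alg {R A Y} Phi u.

(** * Gluing projections *)

Lemma continuous_at_class (R : realType) (Y : topologicalType) (x0 : Y) :
  function_class [set x0] (@continuous_at Y R x0).
Proof.
split=> [c|u v cu cv|u v cu cv|u cu u0].
- exact: cvg_cst.
- exact: cvgD.
- exact: cvgM.
- by apply: cvgV => //; exact: u0.
Qed.

Lemma continuous_at_if (R : realType) (Y : topologicalType) (x0 : Y)
    (b : Y -> bool) (u v : Y -> R) : u x0 = v x0 ->
  continuous_at x0 u -> continuous_at x0 v ->
  continuous_at x0 (fun x => if b x then u x else v x).
Proof.
move=> uv cu cv; rewrite /continuous_at.
have -> : (if b x0 then u x0 else v x0) = u x0 by case: ifP.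
apply/cvgrPdist_lt => e e0.
have /cvgrPdist_lt/(_ e e0) := cu.
have /cvgrPdist_lt/(_ e e0) := cv; rewrite -uv.
by apply: filterS2 => x ? ?; case: ifP.
Qed.

Lemma continuous_at_near (R : realType) (Y : topologicalType) (x0 : Y)
    (u v : Y -> R) : (\forall x \near x0, u x = v x) ->
  continuous_at x0 u -> continuous_at x0 v.
Proof.
move=> uv; rewrite /continuous_at -(nbhs_singleton uv) => cu.
by apply: cvg_trans cu; exact: near_eq_cvg.
Qed.

Section Gluing.
Context (R : realType) (A : staralg R) (Y : topologicalType).
Variables (k : nat) (q : nat -> Y -> R) (p : nat -> A) (f : Y -> A) (e : R).
Hypothesis e0 : 0 < e <= 1 / 1000 / 1000.
Hypothesis f_proj : forall x, projection (f x).
Hypothesis p_proj : forall i, (i < k)%N -> projection (p i).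
Hypothesis p_near : forall i x, (i < k)%N -> 0 <= q i x -> opb (p i - f x) e.
Hypothesis q_cover : forall x, exists2 i, (i < k)%N & 0 < q i x.

Definition wt i x : R := Num.max 0 (q i x).
(** [glue i] is meaningful only where [partial_wt i] is positive, on the union of the first [i]
    balls; elsewhere its value is masked by [ratio i = 0]. *)
Definition partial_wt i x : R := \sum_(j < i) wt j x.
Definition average x : A := \sum_(j < k) sc A (wt j x / partial_wt k x) * p j.
Definition ratio i x : R := partial_wt i x / partial_wt i.+1 x.
Definition mixture i (g : Y -> A) x : A :=
  sc A (1 - ratio i x) + sc A (ratio i x) * g x.

(* Multiplying by [average], which is uniformly close to [f], at every step is
   what keeps the distance from [glue i] to [f] from growing with [i]. *)
Fixpoint glue i : Y -> A :=
  match i with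
  | 0 => fun=> 0
  | i.+1 => fun x =>
      if 0 < q i x then row_proj (p i) (p i * mixture i (glue i) x * average x)
      else row_proj (glue i x) (glue i x * average x)
  end.

Lemma wt_ge0 i x : 0 <= wt i x. Proof. by rewrite le_max lexx. Qed.

Lemma partial_wt_ge0 i x : 0 <= partial_wt i x.
Proof. by apply: sumr_ge0 => j _; exact: wt_ge0. Qed.

Lemma partial_wtS i x : partial_wt i.+1 x = partial_wt i x + wt i x.
Proof. by rewrite /partial_wt big_ord_recr. Qed.

Lemma partial_wt_gt0 x : 0 < partial_wt k x.
Proof.
have [i ik qi] := q_cover x; rewrite lt0r partial_wt_ge0 andbT.
rewrite psumr_neq0; last by move=> j _; exact: wt_ge0.
by apply/hasP; exists (Ordinal ik); rewrite ?mem_index_enum//= lt_max qi orbT.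
Qed.

Lemma ratio_01 i x : 0 < partial_wt i.+1 x -> 0 <= ratio i x <= 1.
Proof.
move=> T0; rewrite /ratio divr_ge0 ?partial_wt_ge0//= ler_pdivrMr// mul1r.
by rewrite partial_wtS lerDl wt_ge0.
Qed.

(** Jensen's inequality for [Q], in the form that a weighted variance is nonnegative. Convexity
    keeps the constant [e] whatever the number of balls. *)
Lemma average_near x : opb (average x - f x) e.
Proof.
move=> v; have T0 := partial_wt_gt0 x.
pose w (j : 'I_k) := wt j x / partial_wt k x; pose z (j : 'I_k) := v * (p j - f x).
have w0 j : 0 <= w j by rewrite divr_ge0 ?wt_ge0 ?partial_wt_ge0.
have w1 : \sum_j w j = 1 by rewrite -mulr_suml divff ?gt_eqF.
set c := average x - f x.
have vc : v * c = \sum_j sc A (w j) * z j.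
  have -> : c = \sum_j sc A (w j) * (p j - f x).
    under [RHS]eq_bigr do rewrite mulrBr.
    rewrite sumrB -mulr_suml.
    have <- : sc A (\sum_j w j) = \sum_j sc A (w j).
      exact: (big_morph _ (@scD R A) (@sc0 R A)).
    by rewrite w1 sc1 mul1r.
  by rewrite mulr_sumr; apply: eq_bigr => j _; rewrite !mulrA sc_comm.
have : 0 <= \sum_j w j * Q (z j - v * c).
  by apply: sumr_ge0 => j _; rewrite mulr_ge0// Q_ge0.
have -> : \sum_j w j * Q (z j - v * c) = \sum_j w j * Q (z j) - Q (v * c).
  have dsum : \sum_j w j * dot (co (z j)) (co (v * c)) = Q (v * c).
    rewrite /Q {2}vc co_sum dot_suml.
    by apply: eq_bigr => j _; rewrite co_sc dotZl.
  under eq_bigr => j _.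
    have -> : w j * Q (z j - v * c) = w j * Q (z j)
        - 2 * (w j * dot (co (z j)) (co (v * c))) + w j * Q (v * c).
      rewrite /Q coB dotBl !dotBr (dotC (co (v * c)) (co (z j))); ring.
    over.
  rewrite big_split sumrB -mulr_sumr dsum -mulr_suml w1 mul1r /=.
  by rewrite mulr_natl mulr2n opprD addrA subrK.
rewrite subr_ge0 => /le_trans; apply.
rewrite -[leRHS]mul1r -w1 mulr_suml; apply: ler_sum => j _.
have [wj|wj] := eqVneq (wt j x) 0; first by rewrite /w wj !mul0r.
apply: ler_wpM2l => //; apply: p_near => //; rewrite leNgt; apply/negP => qj.
by move/eqP: wj; apply; apply/max_idPl/ltW.
Qed.

Lemma partial_wt_step i x : 0 < partial_wt i.+1 x -> q i x <= 0 ->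
  0 < partial_wt i x.
Proof. by move=> + qi; rewrite partial_wtS [wt i x](max_idPl qi) addr0. Qed.

(** When the previous projection serves as the reference, [544 * e] takes the place of [d] in the
    perturbation step; hence the bound 10^-6 on [e]. *)
Let e544 : 544 * e <= 1 / 1000. Proof. by have [_ ?] := andP e0; lra. Qed.
Let e1 : 0 < e <= 1 / 1000. Proof. by case/andP: e0 => -> ? /=; lra. Qed.
Let e2 : e <= 1 / 1000. Proof. by case/andP: e1. Qed.

Let mixture_near i x : (i < k)%N -> 0 <= q i x -> 0 < partial_wt i.+1 x ->
  (0 < partial_wt i x -> opb (glue i x - f x) (544 * e)) ->
  forall u, u * p i = u -> Q (u * mixture i (glue i) x - u) <= 2 / 1000 * Q u.
Proof.
move=> ik qi T1 gi u up.
have [Ti|] := ltrP 0 (partial_wt i x).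
  apply: le_trans (weight_near (p_proj ik) (p_near ik qi) (gi Ti) (ratio_01 T1) up) _.
  by apply: ler_wpM2r; [exact: Q_ge0|have [_ ?] := andP e0; lra].
move=> Ti; have T0 : partial_wt i x = 0.
  by apply/eqP; rewrite eq_le Ti partial_wt_ge0.
rewrite /mixture /ratio T0 mul0r subr0 sc1 sc0 mul0r addr0 mulr1 subrr Q0.
by have := Q_ge0 u; lra.
Qed.

(** The induction closes with a fixed constant because [step_near] returns [544 * e] whatever the
    errors it was given, within its tolerances. *)
Lemma glue_good i x : (i <= k)%N -> 0 < partial_wt i x ->
  projection (glue i x) /\ opb (glue i x - f x) (544 * e).
Proof.
elim: i => [|i IH] ik; first by rewrite /partial_wt big_ord0 ltxx.
move=> T1; rewrite /=; case: ifPn => [/ltW qi|]; last first.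
  rewrite -leNgt => qi; have [pg gn] := IH (ltnW ik) (partial_wt_step T1 qi).
  (* With [W = 1] and [glue i x] as the reference, this branch is an instance of the same
     perturbation step. *)
  have W1 u : u * glue i x = u -> Q (u * 1 - u) <= 2 / 1000 * Q u.
    by rewrite mulr1 subrr Q0; have := Q_ge0 u; lra.
  rewrite -[X in row_proj _ (X * _)]mulr1.
  have ig := step_gram_injective (f_proj x) pg e544 e1 gn (average_near x) W1.
  split; last exact: (step_near (f_proj x) pg e544 e1 gn (average_near x) W1).
  by apply: row_proj_projection => //; rewrite mulr1 mulrA pg.1.
have W1 := mixture_near ik qi T1 (fun Ti => (IH (ltnW ik) Ti).2).
have pp := p_proj ik; have pn := p_near ik qi.
have ig := step_gram_injective (f_proj x) pp e2 e1 pn (average_near x) W1.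
split; last exact: (step_near (f_proj x) pp e2 e1 pn (average_near x) W1).
by apply: row_proj_projection => //; rewrite !mulrA pp.1.
Qed.

Lemma glue_mix_injective i x : (i < k)%N -> 0 <= q i x -> 0 < partial_wt i.+1 x ->
  injective_alg (gram (p i) (p i * mixture i (glue i) x * average x)).
Proof.
move=> ik qi T1.
have W1 := mixture_near ik qi T1 (fun Ti => (glue_good (ltnW ik) Ti).2).
exact: (step_gram_injective (f_proj x) (p_proj ik) e2 e1 (p_near ik qi)
  (average_near x) W1).
Qed.

Lemma glue_avg_injective i x : (i <= k)%N -> 0 < partial_wt i x ->
  injective_alg (gram (glue i x) (glue i x * average x)).
Proof.
move=> ik Ti; have [pg gn] := glue_good ik Ti.
have W1 u : u * glue i x = u -> Q (u * 1 - u) <= 2 / 1000 * Q u.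
  by rewrite mulr1 subrr Q0; have := Q_ge0 u; lra.
have := step_gram_injective (f_proj x) pg e544 e1 gn (average_near x) W1.
by rewrite mulr1.
Qed.

Lemma class_average (S : set Y) (Phi : (Y -> R) -> Prop) : function_class S Phi ->
  (forall i, (i < k)%N -> Phi (wt i)) -> class_alg Phi average.
Proof.
move=> cPhi Pt; have [Pc PD PM PV] := cPhi.
apply: (class_alg_sum cPhi) => j; apply: (class_scM cPhi); last exact: class_cst cPhi _.
apply: PM; first exact: Pt.
apply: PV => [|x _]; last by rewrite gt_eqF// partial_wt_gt0.
by apply: (class_sum cPhi) => l; exact: Pt.
Qed.

Lemma class_partial_wt (S : set Y) (Phi : (Y -> R) -> Prop) i :
  function_class S Phi -> (forall i, (i < k)%N -> Phi (wt i)) -> (i <= k)%N ->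
  Phi (partial_wt i).
Proof.
move=> cPhi Pt ik; apply: (class_sum cPhi) => l; apply: Pt.
exact: leq_trans (ltn_ord l) ik.
Qed.

(** Membership is required of the product [ratio i * glue i] only: [glue i] itself can be
    discontinuous where [partial_wt i] vanishes. *)
Lemma class_mix (S : set Y) (Phi : (Y -> R) -> Prop) i :
  function_class S Phi -> (forall i, (i < k)%N -> Phi (wt i)) -> (i < k)%N ->
  (forall x, S x -> 0 <= q i x /\ 0 < partial_wt i.+1 x) ->
  class_alg Phi (fun x => sc A (ratio i x) * glue i x) ->
  class_alg Phi (fun x => row_proj (p i) (p i * mixture i (glue i) x * average x)).
Proof.
move=> cPhi Pt ik Si Pg; have [Pc PD PM PV] := cPhi.
apply: (class_row_proj cPhi); first exact: class_cst cPhi _.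
  apply: (class_algM cPhi); last exact: class_average cPhi _.
  apply: (class_algM cPhi); first exact: class_cst cPhi _.
  apply: (class_algD cPhi) => //; apply: (class_sc cPhi).
  have Pr : Phi (ratio i).
    apply: (PM); first exact: class_partial_wt cPhi Pt (ltnW ik).
    by apply: PV; [exact: class_partial_wt cPhi Pt _|move=> x /Si[_ T0]; rewrite gt_eqF].
  by apply: PD => //; under eq_fun do rewrite -mulN1r; exact: PM.
by move=> x /Si[qi T1]; exact: glue_mix_injective.
Qed.

Lemma class_avg (S : set Y) (Phi : (Y -> R) -> Prop) i :
  function_class S Phi -> (forall i, (i < k)%N -> Phi (wt i)) -> (i <= k)%N ->
  (forall x, S x -> 0 < partial_wt i x) -> class_alg Phi (glue i) ->
  class_alg Phi (fun x => row_proj (glue i x) (glue i x * average x)).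
Proof.
move=> cPhi Pt ik Si Pg.
apply: (class_row_proj cPhi) => //.
  by apply: (class_algM cPhi) => //; exact: class_average cPhi _.
by move=> x /Si Ti; exact: glue_avg_injective.
Qed.

(** On [S] each maximum [wt i] is either [q i] or 0, and each conditional in [glue] always takes the
    same branch; what is left is built by rational operations. *)
Lemma glue_class (S : set Y) (Phi : (Y -> R) -> Prop) : function_class S Phi ->
  (forall u v, (forall x, S x -> u x = v x) -> Phi u -> Phi v) ->
  (forall i, (i < k)%N -> Phi (q i)) ->
  (forall i, (i < k)%N ->
    (forall x, S x -> 0 < q i x) \/ (forall x, S x -> q i x <= 0)) ->
  class_alg Phi (glue k).
Proof.
move=> cPhi ext Pq Sq; have [Pc _ _ _] := cPhi.
have Pt i : (i < k)%N -> Phi (wt i).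
  move=> ik; have [qi|qi] := Sq i ik.
    by apply: ext (Pq i ik) => x /qi/ltW/max_idPr.
  by apply: ext (Pc 0) => x /qi/max_idPl.
have ST i : (i <= k)%N -> (forall x, S x -> 0 < partial_wt i x) \/
    (forall x, S x -> partial_wt i x = 0).
  elim: i => [|i IH] ik; first by right=> x _; rewrite /partial_wt big_ord0.
  have [qi|qi] := Sq i ik.
    left=> x Sx; rewrite partial_wtS ltr_wpDl ?partial_wt_ge0//.
    by rewrite lt_max qi// orbT.
  have [Ti|Ti] := IH (ltnW ik); [left|right] => x Sx; rewrite partial_wtS.
    by rewrite ltr_wpDr ?wt_ge0// Ti.
  by rewrite Ti// add0r; exact/max_idPl/qi.
suff: forall i, (i <= k)%N -> (forall x, S x -> 0 < partial_wt i x) ->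
    class_alg Phi (glue i).
  by apply=> // x _; exact: partial_wt_gt0.
elim=> [|i IH] ik Si; first exact: class_cst cPhi _.
have [qi|qi] := Sq i ik; last first.
  have Ti x : S x -> 0 < partial_wt i x by move=> Sx; exact: partial_wt_step (Si _ Sx) (qi _ Sx).
  move=> j; apply: ext (class_avg cPhi Pt (ltnW ik) Ti (IH (ltnW ik) Ti) j) => x Sx.
  by rewrite /= ltNge qi.
have Pg : class_alg Phi (fun x => sc A (ratio i x) * glue i x).
  have [Ti|Ti] := ST i (ltnW ik).
    apply: (class_scM cPhi); last exact: IH (ltnW ik) Ti.
    have [_ _ PM PV] := cPhi; apply: PM; first exact: class_partial_wt cPhi Pt (ltnW ik).
    by apply: PV; [exact: class_partial_wt cPhi Pt ik|move=> x /Si T0; rewrite gt_eqF].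
  move=> j; apply: ext (Pc 0) => x Sx.
  by rewrite /ratio Ti// mul0r sc0 mul0r co0 mxE.
have Si' x : S x -> 0 <= q i x /\ 0 < partial_wt i.+1 x.
  by move=> Sx; split; [exact/ltW/qi|exact: Si].
by move=> j; apply: ext (class_mix cPhi Pt ik Si' Pg j) => x Sx; rewrite /= qi.
Qed.

Hypothesis q_cont : forall i, (i < k)%N -> continuous (q i).

Lemma glue_continuous : forall j, continuous (fun x => co (glue k x) ord0 j).
Proof.
suff: forall i x0, (i <= k)%N -> 0 < partial_wt i x0 ->
    class_alg (continuous_at x0) (glue i).
  by move=> h j x0; exact: h (leqnn k) (partial_wt_gt0 x0) j.
elim=> [|i IH] x0 ik; first by rewrite /partial_wt big_ord0 ltxx.
move=> T1; have cPhi := @continuous_at_class R Y x0.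
have Pt l : (l < k)%N -> continuous_at x0 (wt l).
  by move=> lk; apply: continuous_max; [exact: cvg_cst|exact: q_cont].
have PF : 0 <= q i x0 -> class_alg (continuous_at x0)
    (fun x => row_proj (p i) (p i * mixture i (glue i) x * average x)).
  move=> qi; apply: (class_mix cPhi Pt ik) => [x ->//|].
  have Pr : continuous_at x0 (ratio i).
    have [_ _ PM PV] := cPhi; apply: PM; first exact: class_partial_wt cPhi Pt (ltnW ik).
    by apply: PV => [|x ->]; [exact: class_partial_wt cPhi Pt ik|rewrite gt_eqF].
  have [Ti|] := ltrP 0 (partial_wt i x0).
    by apply: (class_scM cPhi) => //; exact: IH (ltnW ik) Ti.
  (* No ball before [i] has weight at [x0]. Nothing is known about the limit of [glue i], but its
     entries are bounded where it is a projection and [ratio i] tends to 0. *)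
  move=> Ti j; have T0 : partial_wt i x0 = 0.
    by apply/eqP; rewrite eq_le Ti partial_wt_ge0.
  have r0 : ratio i x0 = 0 by rewrite /ratio T0 mul0r.
  rewrite /continuous_at r0 sc0 mul0r co0 mxE.
  (* An entry [c] of a projection satisfies [c ^+ 2 <= Q 1], whence [|c| <= Q 1 + 1] without a
     square root. *)
  pose B := Q (1 : A) + 1.
  apply: (@squeeze_cvgr _ _ _ _ (fun x => - (ratio i x * B)) (fun x => ratio i x * B)).
  - near=> x.
    have [Tx|] := ltrP 0 (partial_wt i x); last first.
      move=> Tx; have -> : ratio i x = 0.
        rewrite /ratio (_ : partial_wt i x = 0) ?mul0r//.
        by apply/eqP; rewrite eq_le Tx partial_wt_ge0.
      by rewrite sc0 !mul0r co0 mxE oppr0 lexx.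
    have [pg _] := glue_good (ltnW ik) Tx.
    have r1 : 0 <= ratio i x by rewrite divr_ge0 ?partial_wt_ge0.
    rewrite co_sc mxE -ler_norml normrM (ger0_norm r1) ler_wpM2l//.
    have : (co (glue i x) ord0 j) ^+ 2 <= Q (1 : A).
      rewrite -[glue i x]mul1r; apply: le_trans (Q_proj_le 1 pg).
      rewrite mul1r /Q /dot (bigD1 j)//= -expr2 lerDl.
      by apply: sumr_ge0 => l _; rewrite -expr2 sqr_ge0.
    rewrite /B -real_normK ?num_real//.
    by have := normr_ge0 (co (glue i x) ord0 j); nra.
  - rewrite -oppr0 -(mul0r B) -r0; apply: cvgN; apply: cvgM => //; exact: cvg_cst.
  - by rewrite -(mul0r B) -r0; apply: cvgM => //; exact: cvg_cst.
have PG : 0 < partial_wt i x0 -> class_alg (continuous_at x0)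
    (fun x => row_proj (glue i x) (glue i x * average x)).
  move=> Ti; apply: (class_avg cPhi Pt (ltnW ik)) => [x ->//|].
  exact: IH (ltnW ik) Ti.
have qx0 : q i x @[x --> x0] --> q i x0 := @q_cont i ik x0.
move=> j; have [qi|qi|/esym qi] := ltrgtP 0 (q i x0).
- apply: continuous_at_near (PF (ltW qi) j).
  by move/cvgr_gt : qx0 => /(_ 0 qi); apply: filterS => x /= ->.
- apply: continuous_at_near (PG (partial_wt_step T1 (ltW qi)) j).
  move/cvgr_lt : qx0 => /(_ 0 qi); apply: filterS => x qx /=.
  by rewrite (ltNge 0) (ltW qx).
have Ti : 0 < partial_wt i x0 by apply: partial_wt_step T1 _; rewrite qi.
have qi0 : 0 <= q i x0 by rewrite qi.
have [pg gn] := glue_good (ltnW ik) Ti.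
pose u x := co (row_proj (p i) (p i * mixture i (glue i) x * average x)) ord0 j.
pose v x := co (row_proj (glue i x) (glue i x * average x)) ord0 j.
(* Where [q i] vanishes, [ratio i] is 1 and the mixture is [glue i]; [row_proj_absorb] then
   identifies the two branches. *)
have uv : u x0 = v x0.
  have i1 := glue_mix_injective ik qi0 T1.
  rewrite /u /v; have m1 : mixture i (glue i) x0 = glue i x0.
    rewrite /mixture /ratio partial_wtS [wt i x0](_ : _ = 0) ?addr0; last first.
      by apply/max_idPl; rewrite qi.
    by rewrite divff ?gt_eqF// subrr sc0 sc1 add0r mul1r.
  rewrite m1 in i1 *.
  have near_pg : opb (p i - glue i x0) (2 * e + 2 * (544 * e)).
    have -> : p i - glue i x0 = (p i - f x0) - (glue i x0 - f x0) by abel.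
    by apply: opbD (p_near ik qi0) (opbN gn).
  rewrite (row_proj_absorb _ near_pg) //; first by have [_ ?] := andP e0; lra.
  - exact: p_proj.
  - exact: glue_avg_injective (ltnW ik) Ti.
apply: continuous_at_near (continuous_at_if (b := fun x => 0 < q i x) uv (PF qi0 j) (PG Ti j)).
by apply: nearW => x /=; case: ifP.
Unshelve. all: by end_near. Qed.

End Gluing.

(** * Matrices over the scalars and Grassmannians *)

Section Scalars.
Context {R : realType} {F : scalar_kind}.
Local Notation K := (scalar_ring R F).
Local Notation d := (real_dim F).
Implicit Types x y : K.

Definition crd x (l : nat) : R := (real_coords x)`_l.

Definition scalar_of_coords : 'rV[R]_d -> K :=
  match F return 'rV[R]_(real_dim F) -> scalar_ring R F with
  | RealScalars => fun w => w ord0 ord0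
  | ComplexScalars => fun w => Complex (w ord0 ord0) (w ord0 (inord 1))
  | QuaternionScalars => fun w =>
      Quaternion (w ord0 ord0) (w ord0 (inord 1)) (w ord0 (inord 2)) (w ord0 (inord 3))
  end.

Definition real_scalar : R -> K :=
  match F return R -> scalar_ring R F with
  | RealScalars => id
  | ComplexScalars => fun r => Complex r 0
  | QuaternionScalars => fun r => Quaternion r 0 0 0
  end.

Lemma crdK w (l : 'I_d) : crd (scalar_of_coords w) l = w ord0 l.
Proof.
move: w l; rewrite /crd /scalar_of_coords; case: F => w [[|[|[|[|]]]] //= ?];
  by congr (w _ _); apply: val_inj; rewrite //= inordK.
Qed.

Lemma crd_inj x y : (forall l : 'I_d, crd x l = crd y l) -> x = y.
Proof.
move: x y; rewrite /crd; case: F => /=.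
- by move=> x y /(_ ord0).
- case=> a b [c d'] h; have := h ord0; have := h (inord 1).
  by rewrite /= inordK// => /= -> ->.
- case=> a b c d' [a' b' c' d''] h; have := h ord0; have := h (inord 1).
  have := h (inord 2); have := h (inord 3).
  by rewrite /= !inordK// => /= -> -> -> ->.
Qed.

Lemma crdD x y l : crd (x + y) l = crd x l + crd y l.
Proof.
move: x y; rewrite /crd; case: F => /=.
- by move=> x y; case: l => [|[|l]] //=; rewrite addr0.
- by case=> a b [c d']; case: l => [|[|[|l]]] //=; rewrite addr0.
- by case=> a b c d' [a' b' c' d'']; case: l => [|[|[|[|[|l]]]]] //=; rewrite addr0.
Qed.

Lemma real_scalar_comm r x : real_scalar r * x = x * real_scalar r.
Proof.
move: x; rewrite /real_scalar; case: F => /=.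
- by move=> x; rewrite mulrC.
- by move=> x; rewrite mulrC.
- by case=> a b c d'; congr Quaternion => /=; ring.
Qed.

Lemma crd_scale r x l : crd (real_scalar r * x) l = r * crd x l.
Proof.
move: x; rewrite /crd /real_scalar; case: F => /=.
- by move=> x; case: l => [|[|l]] //=; rewrite mulr0.
- by case=> a b; case: l => [|[|[|l]]] //=; ring.
- by case=> a b c d'; case: l => [|[|[|[|[|l]]]]] //=; ring.
Qed.

Lemma conjD x y : conj_scalar (x + y) = conj_scalar x + conj_scalar y.
Proof.
move: x y; rewrite /conj_scalar; case: F => //=.
- by case=> a b [c d']; congr Complex; ring.
- by case=> a b c d' [a' b' c' d'']; congr Quaternion => /=; ring.
Qed.

Lemma conjM x y : conj_scalar (x * y) = conj_scalar y * conj_scalar x.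
Proof.
move: x y; rewrite /conj_scalar; case: F => /=.
- by move=> x y; rewrite mulrC.
- by case=> a b [c d']; congr Complex; ring.
- by case=> a b c d' [a' b' c' d'']; congr Quaternion => /=; ring.
Qed.

Lemma conjK x : conj_scalar (conj_scalar x) = x.
Proof.
move: x; rewrite /conj_scalar; case: F => //=.
- by case=> a b; congr Complex; ring.
- by case=> a b c d'; congr Quaternion => /=; ring.
Qed.

(** This identity makes the conjugate transpose adjoint to the Euclidean inner product of the real
    coordinates. *)
Lemma crd_mul_conj x y :
  crd (x * conj_scalar y) 0 = \sum_(l < d) crd x l * crd y l.
Proof.
move: x y; rewrite /crd /conj_scalar; case: F => /=.
- by move=> x y; rewrite big_ord1.
- by case=> a b [c d']; rewrite !big_ord_recl big_ord0 /=; ring.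
- by case=> a b c d' [a' b' c' d'']; rewrite !big_ord_recl big_ord0 /=; ring.
Qed.

Lemma conj0 : conj_scalar (0 : K) = 0.
Proof. by apply: (addrI (conj_scalar 0)); rewrite -conjD !addr0. Qed.

Lemma crd0 l : crd 0 l = 0.
Proof. by apply: (addrI (crd 0 l)); rewrite -crdD !addr0. Qed.

Lemma conj_sum (I : Type) (s : seq I) (f : I -> K) :
  conj_scalar (\sum_(i <- s) f i) = \sum_(i <- s) conj_scalar (f i).
Proof. by elim/big_rec2: _ => [|i u v _ <-]; rewrite ?conj0// conjD. Qed.

Lemma crd_sum (I : Type) (s : seq I) (f : I -> K) l :
  crd (\sum_(i <- s) f i) l = \sum_(i <- s) crd (f i) l.
Proof. by elim/big_rec2: _ => [|i u v _ <-]; rewrite ?crd0// crdD. Qed.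

End Scalars.

Section MatrixStarAlgebra.
Context {R : realType} {F : scalar_kind} {n : nat}.
Local Notation K := (scalar_ring R F).
Local Notation d := (real_dim F).
Local Notation coords := (@matrix_coords R F n).
Implicit Types a b p m : 'M[K]_n.

Definition matrix_of_coords (v : 'rV[R]_(n * n * d)) : 'M[K]_n :=
  vec_mx (\row_i scalar_of_coords (row i (vec_mx v))).

Definition adjoint_mx a : 'M[K]_n :=
  \matrix_(i, j) conj_scalar (a j i).

Lemma matrix_coordsE a i j l :
  coords a ord0 (mxvec_index (mxvec_index i j) l) = crd (a i j) l.
Proof. by rewrite mxvecE mxE mxvecE. Qed.

Lemma matrix_coordsK : cancel coords matrix_of_coords.
Proof.
move=> a; apply/matrixP => i j; apply: crd_inj => l.
by rewrite mxE mxE crdK !mxE matrix_coordsE.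
Qed.

Lemma matrix_of_coordsK : cancel matrix_of_coords coords.
Proof.
move=> v; apply/rowP => k; case/mxvec_indexP: k => k l; case/mxvec_indexP: k => i j.
by rewrite matrix_coordsE mxE mxE crdK !mxE.
Qed.

Lemma matrix_coordsD : {morph coords : a b / a + b}.
Proof.
move=> a b; apply/rowP => k; case/mxvec_indexP: k => k l; case/mxvec_indexP: k => i j.
by rewrite mxE !matrix_coordsE mxE crdD.
Qed.

Lemma matrix_scalar_comm r a : (real_scalar r)%:M * a = a * (real_scalar r)%:M.
Proof.
rewrite [LHS]mul_scalar_mx; apply/matrixP => i j.
rewrite [RHS]mxE mxE real_scalar_comm (bigD1 j)//= mxE eqxx mulr1n big1 ?addr0//.
by move=> k kj; rewrite !mxE (negPf kj) mulr0n mulr0.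
Qed.

Lemma matrix_coords_scale r a : coords ((real_scalar r)%:M * a) = r *: coords a.
Proof.
apply/rowP => k; case/mxvec_indexP: k => k l; case/mxvec_indexP: k => i j.
rewrite [RHS]mxE !matrix_coordsE -crd_scale; congr (crd _ _).
by rewrite [_ * a]mul_scalar_mx mxE.
Qed.

Lemma dot_matrix_coords a b :
  dot (coords a) (coords b) = \sum_i \sum_j crd (a i j * conj_scalar (b i j)) 0.
Proof.
transitivity (\sum_k \sum_(l < d) coords a ord0 (mxvec_index k l) *
    coords b ord0 (mxvec_index k l)).
  rewrite /dot (reindex _ (curry_mxvec_bij _ _)) pair_bigA.
  by apply: eq_bigr => -[].
rewrite (reindex _ (curry_mxvec_bij _ _)) [RHS]pair_bigA.
apply: eq_bigr => -[i j] _ /=.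
by rewrite crd_mul_conj; apply: eq_bigr => l _; rewrite !matrix_coordsE.
Qed.

Lemma dot_adjoint a b c :
  dot (coords (a * c)) (coords b) = dot (coords a) (coords (b * adjoint_mx c)).
Proof.
rewrite !dot_matrix_coords; apply: eq_bigr => i _.
transitivity (\sum_j \sum_k crd (a i k * c k j * conj_scalar (b i j)) 0).
  by apply: eq_bigr => j _; rewrite mxE mulr_suml crd_sum.
rewrite exchange_big; apply: eq_bigr => k _ /=.
rewrite -crd_sum mxE conj_sum mulr_sumr; congr (crd _ _); apply: eq_bigr => j _.
by rewrite mxE conjM conjK mulrA.
Qed.

Definition matrix_staralg : staralg R :=
  StarAlg matrix_coordsK matrix_of_coordsK matrix_coordsD matrix_scalar_comm
    matrix_coords_scale dot_adjoint.

End MatrixStarAlgebra.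
Arguments matrix_staralg : clear implicits.

Section GrassmannianPoints.
Context {R : realType} {F : scalar_kind} {n : nat}.
Local Notation K := (scalar_ring R F).
Local Notation A := (matrix_staralg R F n).
Implicit Types (x y : 'rV[K]_n) (a p m : A) (U : set 'rV[K]_n).

Lemma herm_adjoint x y (a : 'M[K]_n) : herm (x *m a) y = herm x (y *m adjoint_mx a).
Proof.
rewrite /herm; transitivity (\sum_i \sum_j x ord0 j * a j i * conj_scalar (y ord0 i)).
  by apply: eq_bigr => i _; rewrite mxE mulr_suml.
rewrite exchange_big; apply: eq_bigr => j _ /=; rewrite mxE conj_sum mulr_sumr.
by apply: eq_bigr => i _; rewrite mxE conjM conjK mulrA.
Qed.

Lemma herm_eq0 x : herm x x = 0 -> x = 0.
Proof.
move=> /(congr1 (fun z => crd z 0)); rewrite crd0 crd_sum.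
under eq_bigr do rewrite crd_mul_conj.
move=> /eqP; rewrite psumr_eq0; last first.
  by move=> i _; apply: sumr_ge0 => l _; rewrite -expr2 sqr_ge0.
move=> /allP h; apply/rowP => i; rewrite mxE; apply: crd_inj => l; rewrite crd0.
have := h i (mem_index_enum i); rewrite /= psumr_eq0 => [/allP h'|l' _]; last first.
  by rewrite -expr2 sqr_ge0.
by have := h' l (mem_index_enum l); rewrite /= mulf_eq0 orbb => /eqP.
Qed.

Lemma rows_eq (a b : 'M[K]_n) : (forall x, x *m a = x *m b) -> a = b.
Proof. by move=> ab; apply/row_matrixP => i; rewrite !rowE. Qed.

Lemma herm0l y : herm 0 y = 0.
Proof. by rewrite /herm big1// => i _; rewrite mxE mul0r. Qed.

Lemma grassmannian_projection r U (P : 'M[K]_n) : subspace_dim r U ->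
  orthogonal_projection U P ->
  @projection R A P /\ (forall u, U u -> u *m P = u).
Proof.
move=> [B [_ ->]] oP.
have uP (u : 'rV[K]_n) : range (fun c : 'rV_r => c *m B) u -> u *m P = u.
  move=> [c _ cu]; have [[c' _ c'u] ou] := oP u.
  apply/esym/eqP; rewrite -subr_eq0; apply/eqP/herm_eq0/ou.
  by exists (c - c') => //; rewrite mulmxBl cu c'u.
split=> //.
have PP : P *m P = P.
  by apply: rows_eq => x; rewrite mulmxA uP//; have [] := oP x.
split=> //.
have adK : adjoint_mx (adjoint_mx P) = P := @starK R A P.
(* The vector [(x - x P) P^*] has norm zero, because [x - x P] is orthogonal to [U]. So
   [P^* = P P^*], and the right-hand side is self-adjoint. *)
have e : adjoint_mx P = P *m adjoint_mx P.
  apply: rows_eq => x; rewrite mulmxA; apply/eqP; rewrite -subr_eq0 -mulmxBl.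
  apply/eqP/herm_eq0; rewrite herm_adjoint adK.
  by have [_] := oP x; apply; have [] := oP ((x - x *m P) *m adjoint_mx P).
have e' : adjoint_mx (P *m adjoint_mx P) = P *m adjoint_mx P.
  by have := @starM R A P (adjoint_mx P); rewrite /= adK.
change (adjoint_mx P = P).
by rewrite -[RHS]adK [X in _ = adjoint_mx X]e e' -e.
Qed.

Lemma projection_orthogonal U (P : 'M[K]_n) : @projection R A P ->
  (forall x, U (x *m P)) -> (forall u, U u -> u *m P = u) ->
  orthogonal_projection U P.
Proof.
move=> [PP sP] UP uP x; split=> // u /uP <-.
have sP' : adjoint_mx P = P := sP.
rewrite -{2}sP' -herm_adjoint -[X in X - _]mulmx1 -mulmxBr -mulmxA.
have -> : (1%:M - P) *m P = 0 by rewrite mulmxBl mul1mx [P *m P]PP subrr.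
by rewrite mulmx0 herm0l.
Qed.

Definition grassmannian_point r (P : 'M[K]_n) :=
  exists U, subspace_dim r U /\ orthogonal_projection U P.

Lemma grassmannian_point_projection r P : grassmannian_point r P ->
  @projection R A P.
Proof. by move=> [U [dU oP]]; have [] := grassmannian_projection dU oP. Qed.

(** The new subspace is [U m]. Since [m] is injective on [U], a basis [B] of [U] is carried to the
    basis [B m], so the dimension is preserved over all three scalar rings at once. *)
Lemma row_proj_grassmannian r p m : grassmannian_point r p -> p * m = m ->
  injective_alg (gram p m) -> grassmannian_point r (row_proj p m).
Proof.
move=> [U [dU oP]] pm ig; have [pp Up] := grassmannian_projection dU oP.
have mi (u : 'rV[K]_n) : u *m p *m m = 0 -> u *m p = 0.
  (* Injectivity is known inside the algebra; repeating [u] in every row makes it an element of the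
     algebra. *)
  move=> um; pose X : A := \matrix_(i < n) u.
  have Xp : X * p = 0.
    apply: (row_proj_injective pp ig); apply/row_matrixP => i.
    by rewrite !row_mul rowK um row0.
  apply/rowP => j; have /(congr1 (row j)) := Xp.
  by rewrite row_mul rowK row0 => ->.
have mE : m *m row_proj p m = m := mul_row_proj pp pm ig.
have [B [Bi UE]] := dU.
exists (range (fun c : 'rV_r => c *m (B *m m))); split.
  exists (B *m m); split=> // c c' /= cc; apply: Bi => /=; apply/eqP.
  have Uc z : U (z *m B) by rewrite UE; exists z.
  rewrite -subr_eq0 -mulmxBl -(Up _ (Uc _)); apply/eqP/mi.
  by rewrite (Up _ (Uc _)) -mulmxA mulmxBl cc subrr.
apply: projection_orthogonal; first exact: row_proj_projection.
  move=> x; have [+ _] := oP (x *m (star m * inva (gram p m))).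
  rewrite UE => -[c _ cE]; exists c => //.
  by rewrite mulmxA cE -mulmxA [p *m m]pm -mulmxA.
by move=> _ [c _ <-]; rewrite -!mulmxA mE.
Qed.

End GrassmannianPoints.

(** * Rational functions and regular maps *)

Section RationalFunctions.
Context {R : realType} {m : nat} {T : Type} (y : T -> 'rV[R]_m).
Implicit Types (S : set T) (p q : mpoly.mpoly m R).

Lemma pevalD p q x : peval (p + q) x = peval p x + peval q x.
Proof. exact: mpoly.mevalD. Qed.

Lemma pevalM p q x : peval (p * q) x = peval p x * peval q x.
Proof. exact: mpoly.mevalM. Qed.

Lemma pevalC (c : R) x : @peval R m (mpoly.mpolyC m c) x = c.
Proof. exact: mpoly.mevalC. Qed.

Definition rational_on S (u : T -> R) : Prop :=
  exists P Q, forall x, S x ->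
    peval Q (y x) != 0 /\ u x = peval P (y x) / peval Q (y x).

Lemma rational_on_class S : function_class S (rational_on S).
Proof.
split=> [c|u v [P [Q uE]] [P' [Q' vE]]|u v [P [Q uE]] [P' [Q' vE]]|u [P [Q uE]] u0].
- exists (mpoly.mpolyC m c), (mpoly.mpolyC m 1) => x _.
  by rewrite !pevalC oner_eq0 divr1.
- exists (P * Q' + P' * Q), (Q * Q') => x Sx.
  have [Q0 ->] := uE x Sx; have [Q0' ->] := vE x Sx.
  by rewrite pevalD !pevalM mulf_neq0// addf_div.
- exists (P * P'), (Q * Q') => x Sx.
  have [Q0 ->] := uE x Sx; have [Q0' ->] := vE x Sx.
  by rewrite !pevalM mulf_neq0// mulf_div.
- exists Q, P => x Sx; have := u0 x Sx; have [Q0 ->] := uE x Sx.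
  by rewrite mulf_eq0 negb_or invr_eq0 => /andP[-> _]; rewrite invf_div.
Qed.

Lemma rational_on_peval S p : rational_on S (peval p \o y).
Proof.
exists p, (mpoly.mpolyC m 1) => x _.
by rewrite pevalC oner_eq0 divr1.
Qed.

Lemma rational_on_ext S u v : (forall x, S x -> u x = v x) ->
  rational_on S u -> rational_on S v.
Proof. by move=> uv [P [Q h]]; exists P, Q => x Sx; rewrite -uv//; exact: h. Qed.

Lemma rational_on_sub S S' u : S' `<=` S -> rational_on S u -> rational_on S' u.
Proof. by move=> SS [P [Q h]]; exists P, Q => x /SS /h. Qed.

End RationalFunctions.

Lemma class_peval (R : realType) (Y : Type) (S : set Y) (Phi : (Y -> R) -> Prop)
    k (G : Y -> 'rV[R]_k) (p : mpoly.mpoly k R) : function_class S Phi ->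
  (forall j, Phi (fun x => G x ord0 j)) -> Phi (fun x => peval p (G x)).
Proof.
move=> cPhi GS; have [Pc _ PM _] := cPhi.
rewrite /peval; under eq_fun do rewrite mpoly.mevalE.
apply: (class_sum cPhi) => mon; apply: PM; first exact: Pc.
by apply: (class_prod cPhi) => i; exact: (class_exp cPhi).
Qed.

Lemma rational_on_comp (R : realType) m T (y : T -> 'rV[R]_m) S k
    (G : T -> 'rV[R]_k) (p : mpoly.mpoly k R) :
  (forall j, rational_on y S (fun x => G x ord0 j)) ->
  rational_on y S (fun x => peval p (G x)).
Proof. exact: class_peval (rational_on_class y S). Qed.

Section RegularMaps.
Context {R : realType} {V : ringed_space R} {m : nat} {Z : set (@affine_space R m)}.
Variables (phi : V -> subspace_of Z) (phi_morph : ringed_morphism phi).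
Implicit Types (q : mpoly.mpoly m R) (S : set (mpoly.mpoly m R)).

Definition coordinates (v : V) : 'rV[R]_m := \val (phi v).
Local Notation y := coordinates.

Definition nonvanishing k (S : set (mpoly.mpoly k R)) : set 'rV[R]_k :=
  [set x | exists2 q, S q & peval q x != 0].

Lemma nonvanishingP k (O : set 'rV[R]_k) : algebraic (~` O) ->
  exists S : set (mpoly.mpoly k R), O = nonvanishing S.
Proof.
move=> [S OS]; exists S; rewrite -(setCK O) OS; apply/seteqP; split=> x /=.
  move=> h; apply: contrapT => h'; apply: h => p Sp; apply: contrapT => px.
  by apply: h'; exists p => //; exact/eqP.
by move=> [q Sq qx] /(_ q Sq) q0; rewrite q0 eqxx in qx.
Qed.

Lemma algebraic_nonvanishing k (S : set (mpoly.mpoly k R)) :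
  algebraic (~` nonvanishing S).
Proof.
exists S; apply/seteqP; split=> x /=.
  by move=> h p Sp; apply/eqP/negPn/negP => px; apply: h; exists p.
by move=> h [q Sq]; rewrite h ?eqxx.
Qed.

Lemma zopen_nonvanishing S : zopen (y @^-1` nonvanishing S).
Proof.
have zO : zopen (\val @^-1` nonvanishing S : set (subspace_of Z)).
  by exists (nonvanishing S) => //; exact: algebraic_nonvanishing.
by have [] := phi_morph zO.
Qed.

Lemma section_nonvanishing q P Q : (forall x, peval q x != 0 -> peval Q x != 0) ->
  section (y @^-1` nonvanishing [set q]) (fun v => peval P (y v) / peval Q (y v)).
Proof.
move=> qQ; pose O := nonvanishing [set q].
have zO : zopen (\val @^-1` O : set (subspace_of Z)).
  by exists O => //; exact: algebraic_nonvanishing.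
have [_ sO] := phi_morph zO.
pose g (z : subspace_of Z) := peval P (\val z) / peval Q (\val z).
apply: (sO g) => z Oz.
exists O, (fun x => peval P x / peval Q x); split=> //.
  exact: algebraic_nonvanishing.
move=> x Ox; exists O; split=> //; first exact: algebraic_nonvanishing.
by exists P, Q => x' [_ -> /qQ].
Qed.

(** As [G] stays in the Grassmannian on all of [O], restricting it to the Zariski closure of [X]
    needs no argument about identities that persist on the closure. *)
Lemma regular_of_rational (F : scalar_kind) (n : nat) (r : 'I_n.+1) (X : set V)
    (f : X -> grassmannian R F n) q
    (G : V -> 'rV[R]_(n * n * real_dim F)) :
  let O := y @^-1` nonvanishing [set q] in
  X `<=` O ->
  (forall j, rational_on y O (fun v => G v ord0 j)) ->
  (forall v, O v -> exists2 P, grassmannian_point r P & G v = matrix_coords P) ->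
  (forall a : X, exists w : grassmannian_rank R F n r,
      f a = existT _ r w /\ \val w = G (\val a)) ->
  regular_map f.
Proof.
move=> O XO rG gG fG.
have gr (z : subspace_of (O `&` zclosure X)) : G (\val z) \in
    [set v | exists U P, [/\ @subspace_dim R F n r U, orthogonal_projection U P &
       v = matrix_coords P]].
  apply/mem_set; have [Oz _] := set_mem (valP z).
  by have [P [U [dU oP]] ->] := gG _ Oz; exists U, P.
pose gt z : grassmannian R F n :=
  existT (fun i : 'I_n.+1 => grassmannian_rank R F n i) r (exist _ (G (\val z)) (gr z)).
exists (O `&` zclosure X); split.
- by move=> v Xv; split; [exact: XO|move=> C [_ ]; exact].
- by exists O => //; exact: zopen_nonvanishing.
exists gt; last first.
  move=> a z az; have [w [-> we]] := fG a; rewrite /gt; congr existT.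
  by apply: val_inj; rewrite /= we az.
move=> U zU.
have cR := rational_on_class y.
split.
  have [N1 aN1 UN1] := zU r; have [S OS] := nonvanishingP aN1.
  (* The numerators of the functions [p (G v)]: on [O] the denominators do not vanish, so [p (G v)]
     and its numerator have the same zeros. *)
  pose S' : set (mpoly.mpoly m R) := [set P | exists2 p, S p & exists Q,
    forall v, O v -> peval Q (y v) != 0 /\
      peval p (G v) = peval P (y v) / peval Q (y v)].
  exists (y @^-1` nonvanishing S'); first exact: zopen_nonvanishing.
  apply/seteqP; split=> z /= zUz.
    have : (existT _ r @^-1` U) (exist _ (G (\val z)) (gr z)) by [].
    rewrite UN1 OS => -[p Sp pz].
    have [P [Q PQ]] := rational_on_comp p rG.
    have [Oz _] := set_mem (valP z).
    exists P; first by exists p => //; exists Q.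
    by have [Q0 e] := PQ _ Oz; move: pz; rewrite /= e mulf_eq0 negb_or => /andP[].
  have [P [p Sp [Q PQ]] P0] := zUz; have [Oz _] := set_mem (valP z).
  suff : (existT _ r @^-1` U) (exist _ (G (\val z)) (gr z)) by [].
  rewrite UN1 OS; exists p => //=; have [Q0 ->] := PQ _ Oz.
  by rewrite mulf_neq0// invr_eq0.
move=> h sh z /= zUz.
have [N1 [g [aN1 N1z sg hg]]] := sh r (exist _ (G (\val z)) (gr z)) zUz.
have [N2 [aN2 N2z [P [Q PQ]]]] := sg _ N1z.
have [S OS] := nonvanishingP aN1; have [S2 OS2] := nonvanishingP aN2.
have [Oz _] := set_mem (valP z).
(* On [S1] the fraction [P / Q] represents the section [h] and has a nonzero denominator at
   [G v]. *)
pose S1 : set V := O `&` G @^-1` (N1 `&` N2).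
have S1z : S1 (\val z) by [].
have S1O : S1 `<=` O by move=> v [].
have [A [B AB]] : rational_on y S1 (fun v => peval P (G v) / peval Q (G v)).
  have [_ _ RM RV] := cR S1; apply: (RM).
    by apply: rational_on_sub S1O _; exact: rational_on_comp.
  apply: RV; first by apply: rational_on_sub S1O _; exact: rational_on_comp.
  by move=> v [_ [N1v N2v]]; have [] := PQ _ N1v N2v.
move: N1z; rewrite /= OS => -[p Sp pz]; move: N2z; rewrite /= OS2 => -[p2 Sp2 p2z].
have [P1 [Q1 PQ1]] := rational_on_comp p rG.
have [P2 [Q2 PQ2]] := rational_on_comp p2 rG.
(* Within [O], nonvanishing of [P1] and [P2] puts [G v] into [N1] and [N2], hence [v] into [S1]; [B]
   is the denominator of the pulled-back section. *)
exists (y @^-1` nonvanishing [set P1 * P2 * B]),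
  (fun v => peval A (y v) / peval B (y v)); split.
- exact: zopen_nonvanishing.
- exists (P1 * P2 * B) => //; rewrite !pevalM !mulf_neq0//.
  + by have [_ e] := PQ1 _ Oz; move: pz; rewrite /= e mulf_eq0 negb_or => /andP[].
  + by have [_ e] := PQ2 _ Oz; move: p2z; rewrite /= e mulf_eq0 negb_or => /andP[].
  + by have [] := AB _ S1z.
- by apply: section_nonvanishing => x; rewrite !pevalM !mulf_eq0 !negb_or => /andP[].
move=> z' zUz' [_ -> /=]; rewrite !pevalM !mulf_eq0 !negb_or => /andP[/andP[a b] _].
have [Oz' _] := set_mem (valP z').
have N1z' : N1 (G (\val z')).
  by rewrite OS; exists p => //; have [Q0 ->] := PQ1 _ Oz'; rewrite mulf_neq0// invr_eq0.
have N2z' : N2 (G (\val z')).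
  by rewrite OS2; exists p2 => //; have [Q0 ->] := PQ2 _ Oz'; rewrite mulf_neq0// invr_eq0.
have [_ <-] := AB (\val z') (conj Oz' (conj N1z' N2z')).
by rewrite hg//=; have [] := PQ _ N1z' N2z'.
Qed.

End RegularMaps.

(** * Topology of Grassmannians *)

Section SubsetTopology.
Context {R : realType} {N : nat} {S : set 'rV[R]_N}.

Lemma nbhs_set_type_ball (v : set_type S) (O : set (set_type S)) :
  nbhs v O <-> exists2 e : R, 0 < e &
    forall w : set_type S, ball (\val v) e (\val w) -> O w.
Proof.
split.
  case=> _ [[B oB <-] Bv] BO.
  have /nbhs_ballP[e e0 eB] : nbhs (\val v : 'rV[R]_N) B by exact: open_nbhs_nbhs.
  by exists e => // w /eB Bw; exact: BO.
move=> [e e0 eO].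
have vb : nbhs v (set_val @^-1` ball (\val v) e).
  exact: (@initial_continuous (set_type S) 'rV[R]_N set_val v _ (nbhsx_ballx _ _ e0)).
by apply: filterS vb => w; exact: eO.
Qed.

End SubsetTopology.

Section GrassmannianTopology.
Context {R : realType} {F : scalar_kind} {n : nat}.
Local Notation W := (grassmannian R F n).
Local Notation A := (matrix_staralg R F n).

Definition gcoord (w : W) : 'rV[R]_(n * n * real_dim F) := \val (projT2 w).
Definition gmatrix (w : W) : A := matrix_of_coords (gcoord w).

Lemma co_gmatrix (w : W) : co (gmatrix w) = gcoord w.
Proof. exact: (@ucoK R A). Qed.

Lemma gmatrix_point (w : W) : grassmannian_point (projT1 w) (gmatrix w).
Proof.
case: w => r [v v_in]; have /= := set_mem v_in; move=> [U [P [dU oP vE]]].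
by exists U; rewrite /gmatrix /gcoord /= vE matrix_coordsK.
Qed.

Lemma nbhs_grassmannianP (w : W) (O : set W) :
  nbhs w O <-> exists2 e : R, 0 < e & forall w' : W,
    projT1 w' = projT1 w -> ball (gcoord w) e (gcoord w') -> O w'.
Proof.
case: w => r v.
have -> : nbhs (existT _ r v : W) O = nbhs v (existT _ r @^-1` O) by [].
split=> [/nbhs_set_type_ball[e e0 eO]|[e e0 eO]].
  by exists e => // -[r' w'] /= rr; subst r' => /eO.
by apply/nbhs_set_type_ball; exists e => // w' ?; exact: eO.
Qed.

Lemma gcoord_near (T : topologicalType) (f : T -> W) (x : T) (e : R) :
  continuous f -> 0 < e ->
  \forall x' \near x, projT1 (f x') = projT1 (f x) /\
    ball (gcoord (f x)) e (gcoord (f x')).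
Proof.
move=> cf e0; apply: (cf x [set w | projT1 w = projT1 (f x) /\ ball (gcoord (f x)) e (gcoord w)]).
by apply/nbhs_grassmannianP; exists e.
Qed.

(** Uniform closeness refines the compact-open topology: the filter [G] of uniform neighbourhoods of
    [f] converges to [f]. Equality of ranks is part of closeness, as the Grassmannians of different
    ranks are disjoint components. *)
Lemma continuous_maps_nbhs (T : topologicalType) (f : continuous_maps T W)
    (N : set (continuous_maps T W)) : nbhs f N ->
  exists2 e : R, 0 < e & forall g : continuous_maps T W,
    (forall x, projT1 (g x) = projT1 (f x) /\ ball (gcoord (f x)) e (gcoord (g x))) ->
    N g.
Proof.
pose close e (g : T -> W) := forall x, projT1 (g x) = projT1 (f x) /\
  ball (gcoord (f x)) e (gcoord (g x)).
pose G : set_system {compact-open, T -> W} :=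
  [set B | exists2 e : R, 0 < e & forall g, close e g -> B g].
have FG : Filter G.
  split; first by exists 1.
    move=> B C [e e0 eB] [c c0 cC]; exists (Num.min e c); first by rewrite lt_min e0.
    move=> g ecg; split; [apply: eB|apply: cC] => x; have [? b] := ecg x; split=> //.
      by apply: le_ball b; rewrite ge_min lexx.
    by apply: le_ball b; rewrite ge_min lexx orbT.
  by move=> B C BC [e e0 eB]; exists e => // g /eB /BC.
have cf : continuous f by exact: cts_fun.
have : G --> (f : {compact-open, T -> W}).
  apply/compact_open_cvgP => K O cK oO fKO.
  move/compact_near_coveringP : cK => cK.
  pose P (e : R) (x' : T) := forall w : W, projT1 w = projT1 (f x') ->
    ball (gcoord (f x')) e (gcoord w) -> O w.
  (* Compactness as a near-covering property, with the radius as the parameter tending to 0 from the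
     right, yields one radius for all of [K]. *)
  have := cK R 0^'+ P _; case.
    move=> x Kx.
    have : nbhs (f x) O by apply: open_nbhs_nbhs; split=> //; apply: fKO; exists x.
    move=> /nbhs_grassmannianP[e e0 eO].
    have e20 : 0 < e / 2 by rewrite divr_gt0.
    exists ([set x' | projT1 (f x') = projT1 (f x) /\
      ball (gcoord (f x)) (e / 2) (gcoord (f x'))], [set c | c < e / 2]).
      split; first exact: gcoord_near.
      exact: nbhs_right_lt.
    move=> [x' c] /= [[tx bx] ce] w tw bw; apply: eO; first by rewrite tw.
    by apply: (@ball_split _ _ (gcoord (f x'))) => //; apply: le_ball bw; exact: ltW.
  move=> e /= e0 h.
  exists (e / 2); first by rewrite divr_gt0.
  move=> g cg _ [x Kx <-]; have [tg bg] := cg x.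
  have e2 : e / 2 < e by rewrite ltr_pdivrMr// mulr_natr mulr2n ltrDl.
  apply: (h (e / 2) _ _ x Kx) => //=; last by rewrite divr_gt0.
  by rewrite sub0r normrN gtr0_norm// divr_gt0.
move=> Gf [_ [[B oB <-] Bf] BN].
have [e e0 eB] : G B by apply: Gf; exact: open_nbhs_nbhs.
by exists e => // g cg; apply: BN; exact: eB.
Qed.

End GrassmannianTopology.

Section OperatorBound.
Context {R : realType} {A : staralg R}.

(** A factor depending only on [D] is enough; [2 ^+ D] comes from splitting off one term at a
    time. *)
Lemma sqr_sum_le D (z : 'I_D -> R) : (\sum_i z i) ^+ 2 <= 2 ^+ D * \sum_i z i ^+ 2.
Proof.
elim: D z => [|D IH] z; first by rewrite !big_ord0 expr0n mulr0.
rewrite !big_ord_recl [2 ^+ _]exprS; have := IH (fun i => z (lift ord0 i)).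
set s := \sum_i z _; set t := \sum_i _ ^+ 2 => h.
have c1 : 1 <= 2 ^+ D :> R by rewrite exprn_ege1// ler1n.
have c2 := ler_wpM2r (sqr_ge0 (z ord0)) c1; rewrite mul1r in c2.
have sq : (z ord0 + s) ^+ 2 <= 2 * z ord0 ^+ 2 + 2 * s ^+ 2.
  have := sqr_ge0 (z ord0 - s); rewrite sqrrB sqrrD; lra.
by apply: le_trans sq _; rewrite -mulrA mulrDr; lra.
Qed.

(** A polynomial in the coordinates of [a] that vanishes at 0: it turns coordinatewise continuity
    into operator bounds. *)
Definition opb_const (a : A) : R :=
  2 ^+ sa_dim A * \sum_j \sum_i lmx a i j ^+ 2.

Lemma opb_opb_const a : opb a (opb_const a).
Proof.
move=> x; rewrite /Q coM /dot /opb_const.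
under eq_bigr do rewrite -expr2 mxE.
set q := \sum_i co x _ _ * _.
rewrite -mulrA mulr_suml mulr_sumr; apply: ler_sum => j _.
apply: le_trans (sqr_sum_le _) _; rewrite ler_wpM2l ?exprn_ge0//.
rewrite mulr_suml; apply: ler_sum => i _; rewrite exprMn mulrC ler_wpM2l ?sqr_ge0//.
by rewrite /q (bigD1 i)//= -expr2 lerDl sumr_ge0// => l _; rewrite -expr2 sqr_ge0.
Qed.

Lemma opb_le (a : A) c d : c <= d -> opb a c -> opb a d.
Proof. by move=> cd h x; apply: le_trans (h x) _; rewrite ler_wpM2r ?Q_ge0. Qed.

Lemma opb_const0 : opb_const 0 = 0.
Proof.
rewrite /opb_const big1 ?mulr0// => j _; rewrite big1// => i _.
by rewrite mxE mulr0 co0 mxE expr0n.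
Qed.

Lemma class_opb_const (Y : Type) (S : set Y) (Phi : (Y -> R) -> Prop) (u : Y -> A) :
  function_class S Phi -> class_alg Phi u -> Phi (fun x => opb_const (u x)).
Proof.
move=> cPhi Pu; have [Pc _ PM _] := cPhi; apply: PM => //.
apply: (class_sum cPhi) => j; apply: (class_sum cPhi) => i.
by apply: (class_exp cPhi); exact: (class_lmx cPhi Pu).
Qed.

End OperatorBound.

Section GrassmannianNear.
Context {R : realType} {F : scalar_kind} {n : nat} {T : topologicalType}.
Variables (f : T -> grassmannian R F n) (a : T) (f_cont : continuous f).

Lemma gmatrix_class : class_alg (@continuous_at _ R a) (gmatrix \o f).
Proof.
move=> j; rewrite /continuous_at; apply/cvg_ballP => e e0.
apply: filterS (gcoord_near a f_cont e0) => x [_ [_ /(_ ord0 j)]].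
by rewrite /comp !co_gmatrix.
Qed.

Lemma gmatrix_near (e : R) : 0 < e ->
  \forall x \near a, projT1 (f x) = projT1 (f a) /\
    opb (gmatrix (f a) - gmatrix (f x)) e.
Proof.
move=> e0; have cPhi := continuous_at_class R a.
have c0 : continuous_at a (fun x => opb_const (gmatrix (f a) - gmatrix (f x))).
  apply: (class_opb_const cPhi); apply: (class_algD cPhi).
    exact: class_cst cPhi _.
  by apply: (class_algN cPhi); exact: gmatrix_class.
have e1 : opb_const (gmatrix (f a) - gmatrix (f a)) < e by rewrite subrr opb_const0.
have c1 : \forall x \near a, opb_const (gmatrix (f a) - gmatrix (f x)) < e.
  by move/cvgr_lt : c0 => /(_ e e1).
apply: filterS2 c1 (gcoord_near a f_cont ltr01) => x /ltW h [t _]; split=> //.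
exact: opb_le h (opb_opb_const _).
Qed.

Lemma continuous_gmatrix (g : T -> grassmannian R F n) :
  (forall x, projT1 (g x) = projT1 (f x)) ->
  (forall j, continuous_at a (fun x => gcoord (g x) ord0 j)) -> continuous_at a g.
Proof.
move=> gf cg O /nbhs_grassmannianP[e e0 eO].
have h1 : \forall x \near a, forall j, ball (gcoord (g a) ord0 j) e (gcoord (g x) ord0 j).
  by apply: filter_forall => j; have /cvg_ballP := cg j; apply.
apply: filterS2 h1 (gcoord_near a f_cont ltr01) => x bx [t _]; apply: eO.
  by rewrite !gf.
by split=> // i j; rewrite ord1.
Qed.

End GrassmannianNear.

(** * Stratification and approximation *)

Section Polynomials.
Context {R : realType} {m : nat}.

Lemma peval_continuous (q : mpoly.mpoly m R) : continuous (peval q).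
Proof.
move=> x; apply: (class_peval (G := id) q (continuous_at_class R x)) => j.
exact: coord_continuous.
Qed.

Lemma peval_sum (I : Type) (s : seq I) (F : I -> mpoly.mpoly m R) x :
  peval (\sum_(i <- s) F i) x = \sum_(i <- s) peval (F i) x.
Proof.
by elim/big_rec2: _ => [|i u v _ <-]; rewrite ?pevalD//; exact: mpoly.meval0.
Qed.

Lemma peval_prod (I : Type) (s : seq I) (P : pred I) (F : I -> mpoly.mpoly m R) x :
  peval (\prod_(i <- s | P i) F i) x = \prod_(i <- s | P i) peval (F i) x.
Proof.
by elim/big_rec2: _ => [|i u v _ <-]; rewrite ?pevalM//; exact: mpoly.meval1.
Qed.

Lemma ball_polynomial (c : 'rV[R]_m) (r : R) : exists q : mpoly.mpoly m R,
  forall x, peval q x = r - \sum_j (x ord0 j - c ord0 j) ^+ 2.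
Proof.
pose l j : mpoly.mpoly m R :=
  mpoly.mpolyX R (mpoly.mnm1 j) + mpoly.mpolyC m (- c ord0 j).
exists (mpoly.mpolyC m r + \sum_j mpoly.mpolyC m (- (1 : R)) * (l j * l j)) => x.
rewrite pevalD pevalC peval_sum -sumrN; congr (_ + _); apply: eq_bigr => j _.
rewrite !pevalM pevalC pevalD pevalC mulN1r expr2.
by rewrite (_ : peval _ x = x ord0 j)//; exact: mpoly.mevalXU.
Qed.

End Polynomials.

Section Approximation.
Context {R : realType} {F : scalar_kind} {V : ringed_space R} {m : nat}.
Context {Z : set (@affine_space R m)}.
Variables (phi : V -> subspace_of Z) (psi : subspace_of Z -> V).
Hypothesis phi_morph : ringed_morphism phi.
Hypotheses (phiK : cancel phi psi) (phi_cont : continuous phi)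
  (psi_cont : continuous psi).
Context {X : set V} (cX : compact X) {n : nat}.
Local Notation W := (grassmannian R F n).
Local Notation A := (matrix_staralg R F n).
Local Notation y := (coordinates phi).

Lemma coordinates_continuous : continuous (y : V -> 'rV[R]_m).
Proof.
move=> v; apply: (@continuous_comp V (set_type Z) 'rV[R]_m phi set_val).
  exact: phi_cont.
exact: (@initial_continuous (set_type Z) 'rV[R]_m set_val).
Qed.

Lemma nbhs_coordinates (a : set_type X) (N : set (set_type X)) : nbhs a N ->
  exists2 r : R, 0 < r & forall b : set_type X,
    ball (y (\val a)) r (y (\val b)) -> N b.
Proof.
case=> _ [[B oB <-] Ba] BN.
have : nbhs (phi (\val a)) (psi @^-1` B).
  by apply: psi_cont; rewrite phiK; exact: open_nbhs_nbhs.
move=> /nbhs_set_type_ball[r r0 rB]; exists r => // b /rB /=.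
by rewrite phiK => Bb; exact: BN.
Qed.

Variables (f : set_type X -> W) (f_cont : continuous f).
Let fA (x : set_type X) : A := gmatrix (f x).

Lemma good_cover (e : R) : 0 < e ->
  exists k (q : nat -> mpoly.mpoly m R) (p : nat -> A) (r : nat -> 'I_n.+1),
  [/\ forall i, (i < k)%N -> grassmannian_point (r i) (p i),
      forall i x, (i < k)%N -> 0 <= peval (q i) (y (\val x)) ->
        projT1 (f x) = r i /\ opb (p i - fA x) e &
      forall x : set_type X, exists2 i, (i < k)%N & 0 < peval (q i) (y (\val x))].
Proof.
move=> e0; pose I : choiceType := (mpoly.mpoly m R * A * 'I_n.+1)%type.
pose good (t : mpoly.mpoly m R * A * 'I_n.+1) := grassmannian_point t.2 t.1.2 /\
  forall x : set_type X, 0 <= peval t.1.1 (y (\val x)) ->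
    projT1 (f x) = t.2 /\ opb (t.1.2 - fA x) e.
have cY : compact (y @` X).
  by apply: continuous_compact => //; exact/continuous_subspaceT/coordinates_continuous.
move: cY; rewrite compact_cover.
move=> /(_ I good (fun t : mpoly.mpoly m R * A * 'I_n.+1 =>
  [set x | 0 < peval t.1.1 x])) [].
- move=> t _.
  apply: (@open_comp _ _ (peval t.1.1) [set z | 0 < z]); last exact: open_gt.
  by move=> x _; exact: peval_continuous.
- move=> _ [v Xv <-]; pose a : set_type X := exist _ v (mem_set Xv).
  have near_a := gmatrix_near a f_cont e0.
  have [r r0 rN] := nbhs_coordinates near_a.
  (* The radius [r / 2] keeps even the closed ball [q >= 0] inside the neighbourhood; the estimates
     are needed at the zeros of [q] too, where the branches of [glue] meet. *)
  have [q qE] := ball_polynomial (y v) ((r / 2) ^+ 2).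
  have r20 : 0 < r / 2 by rewrite divr_gt0.
  exists (q, fA a, projT1 (f a)).
    split; first exact: gmatrix_point.
    move=> x /=; rewrite qE subr_ge0 => h; apply: rN => /=.
    split=> // i j; rewrite ord1 -ball_normE /= distrC.
    have : `|y (\val x) ord0 j - y v ord0 j| <= r / 2.
      rewrite -(@ler_pXn2r _ 2)// ?nnegrE ?normr_ge0 ?(ltW r20)// real_normK ?num_real//.
      apply: le_trans h; rewrite (bigD1 j)//= lerDl.
      by apply: sumr_ge0 => l _; rewrite sqr_ge0.
    by move=> /le_lt_trans; apply; rewrite ltr_pdivrMr// mulr_natr mulr2n ltrDl.
  rewrite /= qE big1 ?subr0 ?exprn_gt0// => j _.
  by rewrite subrr expr0n.
move=> D Dgood Dcov.
pose s : seq I := finmap.enum_fset D.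
pose t0 : I := (0, 0, ord0).
have sgood i : (i < size s)%N -> good (nth t0 s i).
  by move=> ik; apply/set_mem/Dgood; exact: mem_nth.
exists (size s), (fun i => (nth t0 s i).1.1), (fun i => (nth t0 s i).1.2),
  (fun i => (nth t0 s i).2); split.
- by move=> i /sgood[].
- by move=> i x /sgood[_]; apply.
move=> x; have [|t tD tx] := Dcov (y (\val x)).
  by exists (\val x) => //; exact/set_mem/(valP x).
have ts : t \in s by [].
by exists (index t s); rewrite ?index_mem ?nth_index.
Qed.

Section Stratification.
Variables (k : nat) (q : nat -> mpoly.mpoly m R).

Definition zeros (v : V) : {set 'I_k} := [set i : 'I_k | peval (q i) (y v) == 0].
Definition strata : set (set V) := range (fun I : {set 'I_k} => zeros @^-1` [set I]).

Lemma strata_stratification : stratification strata.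
Proof.
split.
- exact/finite_image/finite_finset.
- by move=> _ _ [I _ <-] [J _ <-] [v [/= -> ->]].
- move=> _ [I _ <-].
  exists (y @^-1` nonvanishing [set \prod_(i < k | i \notin I) q i]),
    (~` (y @^-1` nonvanishing [set q i | i in [set i : 'I_k | i \in I]])); split.
  + exact: zopen_nonvanishing.
  + by rewrite /zclosed /= setCK; exact: zopen_nonvanishing.
  apply/seteqP; split=> v /=.
    move=> vI; split.
      exists (\prod_(i < k | i \notin I) q i) => //; rewrite peval_prod.
      by apply/prodf_neq0 => i; rewrite -vI inE.
    by move=> [_ [i iI <-]]; move: iI; rewrite /= -vI inE => /eqP ->; rewrite eqxx.
  move=> [[_ ->]]; rewrite peval_prod => /prodf_neq0 h h'.
  apply/setP => i; rewrite inE; have [iI|iI] := boolP (i \in I).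
    apply/eqP; apply: contrapT => /eqP qi.
    by apply: h'; exists (q i) => //; exists i.
  exact/negbTE/h.
- apply/seteqP; split=> // v _.
  by exists (zeros @^-1` [set zeros v]) => //; exists (zeros v).
Qed.

(** A change of sign would give a zero of [q i] on the component; the stratum then makes [q i]
    vanish on all of it. *)
Lemma component_signs (S : set V) (v : V) i : strata S -> (i < k)%N ->
  let C := connected_component (X `&` S) v in
  (forall x, C x -> 0 < peval (q i) (y x)) \/
  (forall x, C x -> peval (q i) (y x) <= 0).
Proof.
move=> [I _ <-] ik C.
pose u x := peval (q i) (y x).
have cu : continuous u.
  move=> x; apply: (@continuous_comp V 'rV[R]_m R y (peval (q i))).
    exact: coordinates_continuous.
  exact: peval_continuous.
have Su x : C x -> (u x == 0) = (Ordinal ik \in I).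
  by move=> /connected_component_sub[_ /= <-]; rewrite inE.
have : connected (u @` C).
  apply: connected_continuous_connected; first exact: component_connected.
  exact: continuous_subspaceT.
move=> /connected_intervalP iC.
have [|pos] := pselect (exists2 x, C x & 0 < u x); last first.
  by right=> x Cx; rewrite leNgt; apply/negP => ux; apply: pos; exists x.
move=> [x Cx ux]; left=> z Cz; rewrite ltNge; apply/negP => uz.
have [w Cw w0] : (u @` C) 0.
  apply: (iC (u z) (u x)); [by exists z|by exists x|].
  by rewrite uz ltW.
have := Su _ Cw; rewrite w0 eqxx => /esym iI.
by have := Su _ Cx; rewrite iI => /eqP u0; rewrite u0 ltxx in ux.
Qed.

End Stratification.

Lemma rational_extension (C : set V) (CX : C `<=` X) (g : set_type X -> A)
    (p0 : A) (r : 'I_n.+1) (c : R) : c < 1 -> grassmannian_point r p0 ->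
  (forall x, C (\val x) -> projection (g x) /\ opb (p0 - g x) c) ->
  (forall j, rational_on (fun x : set_type X => y (\val x)) (\val @^-1` C)
    (fun x => co (g x) ord0 j)) ->
  forall h : C -> W,
  (forall (a : C) (x : set_type X), \val a = \val x ->
    projT1 (h a) = r /\ gcoord (h a) = co (g x)) ->
  regular_map h.
Proof.
move=> c1 gp0 gC gR h hg.
have p0p : projection p0 := grassmannian_point_projection gp0.
have [PQ PQE] := choice gR => {gR}.
have [Qf QE] := choice PQE => {PQE}; set Pf := PQ in QE.
pose gt v : A := uco (\row_j (peval (Pf j) (y v) / peval (Qf j) (y v))).
have gtE (x : set_type X) : C (\val x) -> gt (\val x) = g x.
  move=> Cx; apply: co_inj; rewrite ucoK; apply/rowP => j; rewrite mxE.
  by have [_ ->] := QE j x Cx.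
pose O1 : set V := y @^-1` nonvanishing [set \prod_j Qf j].
have O1P v : O1 v <-> forall j, peval (Qf j) (y v) != 0.
  split=> [[_ ->]|Qv]; last first.
    by exists (\prod_j Qf j) => //; rewrite peval_prod; apply/prodf_neq0.
  by rewrite peval_prod => /prodf_neq0 + j; apply.
have cO := rational_on_class y O1.
have gt1 : class_alg (rational_on y O1) gt.
  move=> j; exists (Pf j), (Qf j) => v /O1P Qv.
  by rewrite ucoK mxE.
pose M v := p0 * gt v.
have p0M v : p0 * M v = M v by rewrite mulrA p0p.1.
have M1 : class_alg (rational_on y O1) M.
  by apply: (class_algM cO) => //; exact: class_cst cO _.
have gr1 : class_alg (rational_on y O1) (fun v => gram p0 (M v)).
  by apply: (class_gram cO) => //; exact: class_cst cO _.
have [N1 [N2 NE]] := class_det cO (class_lmx cO gr1).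
(* Denominators of [gt] times the numerator [N1] of the Gram determinant: [O] is where [gt] is
   defined and the Gram element is invertible. *)
pose q := \prod_j Qf j * N1.
pose O : set V := y @^-1` nonvanishing [set q].
have OP v : O v <-> O1 v /\ injective_alg (gram p0 (M v)).
  split=> [[_ -> qv]|[ov iv]].
    move: qv; rewrite pevalM mulf_eq0 negb_or => /andP[Qv N1v].
    have O1v : O1 v by exists (\prod_j Qf j).
    split=> //; apply/det_lmx; have [N2v ->] := NE v O1v.
    by rewrite mulf_neq0// invr_eq0.
  exists q => //; rewrite pevalM mulf_neq0//; first by case: ov => _ ->.
  move/det_lmx : iv; have [_ ->] := NE v ov.
  by rewrite mulf_eq0 negb_or => /andP[].
have OO1 : O `<=` O1 by move=> v /OP[].
have cO' := rational_on_class y O.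
have CO : C `<=` O.
  move=> v Cv; pose x : set_type X := exist _ v (mem_set (CX v Cv)).
  have Cx : C (\val x) by [].
  have [gp gn] := gC x Cx; apply/OP; split.
    by apply/O1P => j; have [] := QE j x Cx.
  by rewrite /M (gtE x Cx); exact: near_gram_injective gn p0p.
have rO : class_alg (rational_on y O) (fun v => row_proj p0 (M v)).
  apply: (class_row_proj cO'); first exact: class_cst cO' _.
    by move=> j; exact: rational_on_sub OO1 (M1 j).
  by move=> v /OP[].
apply: (regular_of_rational phi_morph (r := r) (q := q)
  (G := fun v => co (row_proj p0 (M v)))) => //.
- move=> v /OP[_ iv]; exists (row_proj p0 (M v)) => //.
  exact: row_proj_grassmannian.
move=> a; have Ca : C (\val a) := set_mem (valP a).
pose x : set_type X := exist _ (\val a) (mem_set (CX _ Ca)).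
have Cx : C (\val x) by [].
have [gp gn] := gC x Cx; have [hr hx] := hg a x erefl.
rewrite /M (gtE x Cx) (row_proj_id c1 gn)// -hx.
by case: (h a) hr => r' w /= rr; subst r'; exists w.
Qed.

Lemma piecewise_regular_approximation (eps : R) : 0 < eps ->
  exists g : continuousType (set_type X) W, piecewise_regular g /\
    forall x, projT1 (g x) = projT1 (f x) /\
      ball (gcoord (f x)) eps (gcoord (g x)).
Proof.
move=> eps0; pose B := Q (1 : A) + 1.
have B0 : 0 < B by rewrite /B ltr_wpDl ?Q_ge0.
(* The first bound is the tolerance of the gluing. The second makes [544 * e * Q 1], which bounds
   the square of each coordinate of [g - f], smaller than [eps ^+ 2]; [B] is [Q 1] made positive. *)
pose e := Num.min (1 / 1000 / 1000) (eps ^+ 2 / B / 1000).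
have e0 : 0 < e <= 1 / 1000 / 1000.
  rewrite ge_min lexx andbT lt_min; apply/andP; split; first by lra.
  by rewrite !divr_gt0 ?exprn_gt0 ?ltr0n.
have eB : 544 * e * Q (1 : A) < eps ^+ 2.
  have : e <= eps ^+ 2 / B / 1000 by rewrite ge_min lexx orbT.
  rewrite -(ler_pM2r B0) mulrAC divfK ?gt_eqF// => h.
  have [e1 _] := andP e0; have := mulr_gt0 e1 B0.
  have : e * Q (1 : A) <= e * B by rewrite ler_pM2l// lerDl.
  by have := exprn_gt0 2 eps0; lra.
have [k [q [p [r [pr pq qc]]]]] := good_cover (proj1 (andP e0)).
pose q' i (x : set_type X) := peval (q i) (y (\val x)).
have pp i : (i < k)%N -> projection (p i).
  by move=> /pr; exact: grassmannian_point_projection.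
have fp x : projection (fA x) := grassmannian_point_projection (gmatrix_point (f x)).
have pn i x : (i < k)%N -> 0 <= q' i x -> opb (p i - fA x) e.
  by move=> ik qi; have [] := pq i x ik qi.
pose g := glue k q' p k.
have gg x : projection (g x) /\ opb (g x - fA x) (544 * e).
  exact: (glue_good e0 fp pp pn qc) (leqnn k) (partial_wt_gt0 qc x).
have e544 : 544 * e < 1 by have [_ ?] := andP e0; lra.
(* [g x] has the rank of [f x], being the row projection of [fA x * g x] with reference [fA x]. *)
have gp x : grassmannian_point (projT1 (f x)) (g x).
  have [gp gn] := gg x.
  have fg : opb (fA x - g x) (544 * e) by rewrite -opprB; exact: opbN.
  rewrite -(row_proj_id e544 fg (fp x) gp).
  apply: row_proj_grassmannian; first exact: gmatrix_point.
    by rewrite mulrA (fp x).1.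
  exact: near_gram_injective fg (fp x).
have gw x : matrix_coords (g x) \in [set v | exists U P,
    [/\ @subspace_dim R F n (projT1 (f x)) U, orthogonal_projection U P &
       v = matrix_coords P]].
  by apply/mem_set; have [U [dU oP]] := gp x; exists U, (g x).
pose gh x : W := existT (fun i : 'I_n.+1 => points (grassmannian_rank R F n i))
  (projT1 (f x)) (exist _ (matrix_coords (g x)) (gw x)).
have gball x : ball (gcoord (f x)) eps (gcoord (gh x)).
  split=> // i j; rewrite ord1 -ball_normE /= -/(gcoord (f x)) -co_gmatrix.
  have [_ gn] := gg x; have := gn 1; rewrite mul1r => Qle.
  have : (co (g x - fA x) ord0 j) ^+ 2 < eps ^+ 2.
    apply: le_lt_trans eB; apply: le_trans Qle.
    rewrite /Q /dot (bigD1 j)//= -expr2 lerDl.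
    by apply: sumr_ge0 => l _; rewrite -expr2 sqr_ge0.
  rewrite -real_normK ?num_real// ltr_pXn2r// ?nnegrE ?normr_ge0 ?ltW//.
  by rewrite coB !mxE distrC.
have q'c i : (i < k)%N -> continuous (q' i).
  move=> _ x; apply: (@continuous_comp (set_type X) 'rV[R]_m R (y \o set_val)).
    apply: (@continuous_comp (set_type X) V 'rV[R]_m set_val y).
      exact: (@initial_continuous (set_type X) V set_val).
    exact: coordinates_continuous.
  exact: peval_continuous.
have gc : continuous gh.
  move=> x; apply: (continuous_gmatrix f_cont) => // j.
  exact: (glue_continuous e0 fp pp pn qc q'c).
pose gb : continuousType (set_type X) W := HB.pack gh (isContinuous.Build _ _ gh gc).
exists gb; split; last by move=> x; split=> //; exact: gball.
exists (strata k q); split; first exact: strata_stratification.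
move=> S sS x0 [Xx0 Sx0]; set C := connected_component _ _.
pose a0 : set_type X := exist _ x0 (mem_set Xx0).
have [i0 i0k qi0] := qc a0.
have sgn i : (i < k)%N -> (forall v, C v -> 0 < peval (q i) (y v)) \/
    (forall v, C v -> peval (q i) (y v) <= 0).
  by move=> ik; exact: (@component_signs k q S x0 i sS ik).
have Cx0 : C x0 by exact: connected_component_refl.
have pos v : C v -> 0 < peval (q i0) (y v).
  by have [|/(_ _ Cx0)] := sgn i0 i0k; [exact|rewrite leNgt qi0].
apply: (@rational_extension C (@component_sub _ V X S x0) g (p i0) (r i0)
  (2 * e + 2 * (544 * e))).
- by have [_ ?] := andP e0; lra.
- exact: pr.
- move=> x Cx; have [gxp gn] := gg x; split=> //.
  have -> : p i0 - g x = (p i0 - fA x) - (g x - fA x) by abel.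
  apply: opbD; last exact: opbN.
  by apply: pn => //; apply/ltW/pos.
- apply: (glue_class e0 fp pp pn qc); first exact: rational_on_class.
  + by move=> u v uv; exact: rational_on_ext.
  + by move=> i _; exact: rational_on_peval.
  + move=> i /sgn[h|h]; [left|right] => x; exact: h.
move=> a x ax.
have -> : (gb \o set_inclusion (@component_sub _ V X S x0)) a = gb x.
  by congr (gb _); apply: val_inj; rewrite /= ax.
split=> //=; have Cx : C (\val x) by rewrite -ax; exact: set_mem (valP a).
by have [] := pq i0 x i0k (ltW (pos _ Cx)).
Qed.

End Approximation.

Theorem theorem1p3 (R : realType) (F : scalar_kind)
  (V : ringed_space R) (hV : real_algebraic_variety V)
  (X : set V) (hX : compact X)
  (n : nat) (hn : (0 < n)%N)
  (f : continuous_maps (set_type X) (grassmannian R F n))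
  (N : set (continuous_maps (set_type X) (grassmannian R F n)))
  (hN : nbhs f N) :
  exists g, N g /\ piecewise_regular g.
Proof.
have [m [Z [_ [phi [psi [[phiK _ phi_morph _] [phi_cont psi_cont]]]]]]] := hV.
have [e e0 eN] := continuous_maps_nbhs hN.
have f_cont : continuous f by exact: cts_fun.
have [g [pg fg]] :=
  piecewise_regular_approximation phi_morph phiK phi_cont psi_cont hX f_cont e0.
by exists g; split=> //; exact: eN.
Qed.
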